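(* If $E=(E^0,E^1,r,s)$ is a row-finite directed graph satisfying Condition (L), and $J$ is a regular ideal in $C^*(E)$, then $J$ is gauge-invariant.
   Context: A directed graph $E=(E^0,E^1,r,s)$ has vertex set $E^0$, edge set $E^1$, and range and source maps $r,s:E^1\to E^0$; it is row-finite if $r^{-1}(v)$ is finite for every $v\in E^0$. A path of length $N\geq 1$ is a sequence of edges $\alpha=\alpha_1\alpha_2\cdots\alpha_N$ with $s(\alpha_i)=r(\alpha_{i+1})$; put $r(\alpha)=r(\alpha_1)$ and $s(\alpha)=s(\alpha_N)$. Such a path is a cycle if $r(\alpha)=s(\alpha)$. $E$ satisfies Condition (L) if every cycle has an entry: for every cycle $\alpha=\alpha_1\cdots\alpha_n$ there exist an index $i$ and an edge $e\in E^1$ with $e\neq\alpha_i$ and $r(e)=r(\alpha_i)$. $C^*(E)$ is the universal $C^*$-algebra generated by a Cuntz-Krieger $E$-family $\{s_e,p_v: e\in E^1, v\in E^0\}$: the $p_v$ are mutually orthogonal projections, the $s_e$ are partial isometries, $s_e^*s_e=p_{s(e)}$ for all $e\in E^1$, and $p_v=\sum_{r(e)=v}s_es_e^*$ whenever $r^{-1}(v)\neq\emptyset$ (the convention of Raeburn's monograph). The gauge action $\gamma$ of $\mathbb{T}$ on $C^*(E)$ is determined by $\gamma_z(s_e)=zs_e$, $\gamma_z(p_v)=p_v$. Ideals are closed and two-sided; an ideal $J$ is gauge-invariant if $\gamma_z(J)=J$ for all $z\in\mathbb{T}$. For a subset $X$ of a $C^*$-algebra $A$, $X^\perp=\{a\in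 A: ax=xa=0\text{ for all }x\in X\}$, and $X^{\perp\perp}=(X^\perp)^\perp$. An ideal $J$ of $A$ is regular if $J=J^{\perp\perp}$. *)

(* Defs.v *)
From HB Require Import structures.
From mathcomp Require Import all_boot all_order all_algebra.
From mathcomp Require Import complex.
From mathcomp Require Import all_classical all_reals all_analysis.

Set Implicit Arguments.
Unset Strict Implicit.
Unset Printing Implicit Defensive.

Import Order.TTheory GRing.Theory Num.Theory.
Import numFieldNormedType.Exports.

Local Open Scope classical_set_scope.
Local Open Scope ring_scope.

(* No unit is assumed: C*(E) has one only when E has finitely many vertices.
   MathComp's ring structures are all unital, hence the product [cmul].
   Norms take their (real, nonnegative) values in [R[i]]. *)
HB.mixin Record isCStarAlgebra (R : realType) A
    & CompleteNormedModule R[i] A := {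
  cmul : A -> A -> A;
  cstar : A -> A;
  cmulA : forall a b c : A, cmul a (cmul b c) = cmul (cmul a b) c;
  cmulDl : forall a b c : A, cmul (a + b) c = cmul a c + cmul b c;
  cmulDr : forall a b c : A, cmul a (b + c) = cmul a b + cmul a c;
  cmulZl : forall (k : R[i]) (a b : A), cmul (k *: a) b = k *: cmul a b;
  cmulZr : forall (k : R[i]) (a b : A), cmul a (k *: b) = k *: cmul a b;
  cstarK : forall a : A, cstar (cstar a) = a;
  cstarD : forall a b : A, cstar (a + b) = cstar a + cstar b;
  cstarZ : forall (k : R[i]) (a : A), cstar (k *: a) = Num.conj k *: cstar a;
  cstarM : forall a b : A, cstar (cmul a b) = cmul (cstar b) (cstar a);
  normcM : forall a b : A, `|cmul a b| <= `|a| * `|b|;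
  cstar_identity : forall a : A, `|cmul (cstar a) a| = `|a| ^+ 2
}.

#[short(type="cstarAlgType")]
HB.structure Definition CStarAlgebra (R : realType) :=
  { A of CompleteNormedModule R[i] A & isCStarAlgebra R A }.

Notation "a ** b" := (cmul a b) (at level 40, left associativity) : ring_scope.

Section CStarAlgebras.
Variable R : realType.
Implicit Types A B : cstarAlgType R.

Record star_hom A B (f : A -> B) : Prop := StarHom {
  star_hom_linear : linear f;
  star_homM : forall a b, f (a ** b) = f a ** f b;
  star_hom_cstar : forall a, f (cstar a) = cstar (f a)
}.

Record star_subalgebra A (S : set A) : Prop := StarSubalgebra {
  subalg0 : S 0;
  subalgD : forall a b, S a -> S b -> S (a + b);
  subalgZ : forall (k : R[i]) a, S a -> S (k *: a);
  subalgM : forall a b, S a -> S b -> S (a ** b);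
  subalg_cstar : forall a, S a -> S (cstar a)
}.

Definition generates A (X : set A) : Prop :=
  forall S : set A, star_subalgebra S -> closed S -> X `<=` S -> S = setT.

Record closed_ideal A (J : set A) : Prop := ClosedIdeal {
  ideal0 : J 0;
  idealD : forall a b, J a -> J b -> J (a + b);
  idealZ : forall (k : R[i]) a, J a -> J (k *: a);
  idealMl : forall a b, J b -> J (a ** b);
  idealMr : forall a b, J a -> J (a ** b);
  ideal_closed : closed J
}.

Definition perp A (X : set A) : set A :=
  [set a | forall x, X x -> a ** x = 0 /\ x ** a = 0].

Definition regular_ideal A (J : set A) : Prop :=
  closed_ideal J /\ J = perp (perp J).

Definition is_projection A (a : A) : Prop := cstar a = a /\ a ** a = a.

Definition is_partial_isometry A (a : A) : Prop := a ** cstar a ** a = a.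

End CStarAlgebras.

Record digraph := Digraph {
  vertex : choiceType;
  edge : choiceType;
  rng : edge -> vertex;
  src : edge -> vertex
}.

Definition row_finite (E : digraph) : Prop :=
  forall v : vertex E, finite_set (@rng E @^-1` [set v]).

(* Paths are composed from right to left. *)
Definition composable (E : digraph) : rel (edge E) :=
  fun e f => src e == rng f.

Definition is_cycle (E : digraph) (alpha : seq (edge E)) : Prop :=
  if alpha is e :: p
  then path (@composable E) e p /\ rng e = src (last e p)
  else False.

Definition condition_L (E : digraph) : Prop :=
  forall alpha : seq (edge E), is_cycle alpha ->
    exists a e : edge E, [/\ a \in alpha, e <> a & rng e = rng a].

Section GraphAlgebras.
Variables (R : realType) (E : digraph).
Implicit Types A B : cstarAlgType R.

(* The sum over [r^-1(v)] has its usual meaning when [E] is row-finite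
   (it is 0 by convention if infinitely many terms are nonzero). *)
Record CK_family A (p : vertex E -> A) (s : edge E -> A) : Prop := CKFamily {
  CK_proj : forall v, is_projection (p v);
  CK_orth : forall v w, v <> w -> p v ** p w = 0;
  CK_pisom : forall e, is_partial_isometry (s e);
  CK_src : forall e, cstar (s e) ** s e = p (src e);
  CK_rng : forall v, @rng E @^-1` [set v] !=set0 ->
    p v = \sum_(e \in @rng E @^-1` [set v]) s e ** cstar (s e)
}.

(* [A], with the family [p], [s], is C*(E).  The homomorphism in
   [universal_hom] is unique because [A] is generated by the family. *)
Record is_graph_algebra A (p : vertex E -> A) (s : edge E -> A) : Prop :=
  IsGraphAlgebra {
    universal_family : CK_family p s;
    universal_generated : generates (range p `|` range s);
    universal_hom : forall B (q : vertex E -> B) (t : edge E -> B),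
      CK_family q t ->
      exists phi : A -> B,
        [/\ star_hom phi, forall v, phi (p v) = q v &
            forall e, phi (s e) = t e]
  }.

(* The circle is [{z : R[i] | `|z| = 1}]; the values of [gamma z] for other
   [z] are irrelevant.  That [gamma] is an action by automorphisms follows, as
   star-homomorphisms are determined by their values on generators. *)
Definition is_gauge_action A (p : vertex E -> A) (s : edge E -> A)
    (gamma : R[i] -> A -> A) : Prop :=
  forall z : R[i], `|z| = 1 ->
    [/\ star_hom (gamma z), forall v, gamma z (p v) = p v &
        forall e, gamma z (s e) = z *: s e].

Definition gauge_invariant A (gamma : R[i] -> A -> A) (J : set A) : Prop :=
  forall z : R[i], `|z| = 1 -> gamma z @` J = J.

Lemma CK_family_rotate A (p : vertex E -> A) (s : edge E -> A) (z : R[i]) :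
  `|z| = 1 -> CK_family p s -> CK_family p (fun e => z *: s e).
Proof.
move=> z1 [pP pO sP sS rS].
have zz : z * Num.conj z = 1 by rewrite -normCK z1 expr1n.
split=> //.
- move=> e; rewrite /is_partial_isometry cstarZ !(cmulZl, cmulZr) !scalerA.
  by rewrite -mulrA zz mulr1 sP.
- by move=> e; rewrite cstarZ cmulZl cmulZr scalerA mulrC zz scale1r.
- move=> v vN0; rewrite rS//; apply: eq_fsbigr => e _.
  by rewrite cstarZ cmulZl cmulZr scalerA zz scale1r.
Qed.

Lemma gauge_action_exists A (p : vertex E -> A) (s : edge E -> A) :
  is_graph_algebra p s -> exists gamma, is_gauge_action p s gamma.
Proof.
move=> [ck _ univ].
have /choice[gamma gammaP] (z : R[i]) : exists phi : A -> A, `|z| = 1 ->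
    [/\ star_hom phi, forall v, phi (p v) = p v &
        forall e, phi (s e) = z *: s e].
  have [z1|zN1] := pselect (`|z| = 1); last by exists id => /zN1.
  by have [phi phiP] := univ A p _ (CK_family_rotate z1 ck); exists phi.
by exists gamma.
Qed.

End GraphAlgebras.

(* Main.v *)
(* The heart of the matter is that, under Condition (L), a nonzero closed ideal
   [K] of [C*(E)] contains some vertex projection.  Granting this, let [J] be
   regular and [z] on the circle: the ideal of those [y] in [perp J] with
   [gamma z^-1 y] in [J] contains no vertex projection, since [gamma] fixes
   them, so it vanishes.  It contains [gamma z a ** x] and [x ** gamma z a] for
   [a] in [J] and [x] in [perp J], whence [gamma z a] is in [perp (perp J) = J].

   To find a vertex projection in [K], take a nonzero [a] in [K].  By Fejer
   summation along roots of unity, the elements [b] of the dense span of the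
   [s_mu s_nu^*] which approximate [a] have a component [b_n] of some degree
   [n] with norm bounded below.  There is then a linear combination [xi] of
   paths of one length with the same source [w] such that [eta = b_n xi] is
   large compared to [xi], and [eta^* b_n xi] is a multiple of [p_w].  By
   Condition (L), compressing by a suitable path out of [w] kills the
   contribution to [eta^* b xi] of the other degrees.  So a multiple of a vertex
   projection is close to [K], and a Neumann series puts the projection in [K].

   That vertex projections are nonzero follows from the universal property and
   a representation of [E] on the Hilbert space [l^2 (E^0 x nat)].  Spectral
   theory is avoided: homomorphisms are contractive because self-adjoint
   contractions are real parts of unitaries, and positivity only enters through
   the fact that a projection is an extreme point of the unit ball of its
   corner. *)

(* The usual route passes to the degree zero part of a^* a and relies on a faithful conditional
   expectation, hence on positivity. A component of arbitrary degree n avoids this: it has to be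
   large, not positive. The obstacle is then the order of choices. The final estimate compares the
   error |a - b| with the size of the component, so the lower bound must depend on a alone and hold
   for approximations b of any precision. Contractivity of the Fejer means, that is, of the gauge
   homomorphisms, gives this uniformity. The paths in xi share length and source so that the s_mu
   behave like orthonormal vectors with scalars in C p_w. This makes eta^* eta equal to z p_w with
   |z| = |eta|^2, and as eta is large compared to xi, dividing by z leaves an error below 1.
   Positivity is also implicit in the Cuntz-Krieger relations, which control the range projections
   of the edges into one vertex only through their sum. Their mutual orthogonality is what extreme
   points are used for. *)
Require Import Defs.
From HB Require Import structures.
From mathcomp Require Import all_boot all_order all_algebra.
From mathcomp Require Import cyclic separable cyclotomic.
From mathcomp Require Import complex finmap.
From mathcomp Require Import all_classical all_reals all_analysis.
From mathcomp Require Import ring lra zify.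

Set Implicit Arguments.
Unset Strict Implicit.
Unset Printing Implicit Defensive.

Import Order.TTheory GRing.Theory Num.Theory.
Import numFieldNormedType.Exports.

Local Open Scope classical_set_scope.
Local Open Scope ring_scope.

(** * Norms and elementary algebra *)

Section Norms.
Variables (R : realType) (V : normedModType R[i]).
Implicit Types (x y : V).

(* A real-valued copy of the norm: the order of [R[i]] is only partial. *)
Definition nr x : R := complex.Re `|x|.

Lemma nrE x : `|x| = (nr x)%:C%C.
Proof. by rewrite /nr RRe_real// realE normr_ge0. Qed.

Lemma nr_ge0 x : 0 <= nr x.
Proof. by rewrite -lecR -nrE normr_ge0. Qed.

Lemma nr0 : nr 0 = 0.
Proof. by rewrite /nr normr0. Qed.

Lemma nr0_eq0 x : nr x = 0 -> x = 0.
Proof. by move=> x0; apply: normr0_eq0; rewrite nrE x0. Qed.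

Lemma nr_gt0 x : x <> 0 -> 0 < nr x.
Proof.
by move=> x0; rewrite lt0r nr_ge0 andbT; apply/eqP => /nr0_eq0.
Qed.

Lemma nrD x y : nr (x + y) <= nr x + nr y.
Proof. by rewrite -lecR rmorphD/= -!nrE ler_normD. Qed.

Lemma nrN x : nr (- x) = nr x.
Proof. by rewrite /nr normrN. Qed.

Lemma nrC x y : nr (x - y) = nr (y - x).
Proof. by rewrite -nrN opprB. Qed.

Lemma nrB x y : nr (x - y) <= nr x + nr y.
Proof. by rewrite (le_trans (nrD _ _))// nrN. Qed.

Lemma nrBB y x z : nr (x - z) <= nr (x - y) + nr (y - z).
Proof. by rewrite -[x - z](subrKA y) nrD. Qed.

Lemma nrZ (k : R[i]) x : nr (k *: x) = complex.Re `|k| * nr x.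
Proof.
rewrite /nr normrZ (nrE x) -(RRe_real (ger0_real (normr_ge0 k))).
by rewrite -rmorphM/=.
Qed.

Lemma nrZR (k : R) x : 0 <= k -> nr (k%:C%C *: x) = k * nr x.
Proof.
by move=> k0; rewrite nrZ normc_def/= expr0n addr0 sqrtr_sqr ger0_norm.
Qed.

Lemma nr_sum (I : Type) (l : seq I) (F : I -> V) :
  nr (\sum_(i <- l) F i) <= \sum_(i <- l) nr (F i).
Proof.
elim/big_rec2 : _ => [|i y x _ xy]; first by rewrite nr0.
by rewrite (le_trans (nrD _ _))// lerD2l.
Qed.

Lemma nr_small x : (forall e : R, 0 < e -> nr x < e) -> x = 0.
Proof.
move=> x0; apply: nr0_eq0; apply/eqP; rewrite eq_le nr_ge0 andbT leNgt.
by apply/negP => /[dup] /x0; rewrite ltxx.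
Qed.

Lemma closed_approx (S : set V) x : closed S ->
  (forall e : R, 0 < e -> exists2 y, S y & nr (x - y) < e) -> S x.
Proof.
move=> Sc Sx; apply: Sc => B /nbhs_ballP[e /= e0 Be].
have er : e \is Num.real by exact: gtr0_real.
have [|y Sy xy] := Sx (complex.Re e); first by rewrite -ltcR RRe_real.
exists y; split => //; apply: Be; rewrite -ball_normE /ball_ /= nrE.
by rewrite -[ltRHS]RRe_real// ltcR.
Qed.

Lemma approx_closed (S : set V) :
  (forall x, (forall e : R, 0 < e -> exists2 y, S y & nr (x - y) < e) -> S x) ->
  closed S.
Proof.
move=> SP x clx; apply: SP => e e0.
have [|y [Sy]] := clx (ball x e%:C%C).
  by apply: nbhsx_ballx; rewrite ltcR.
by rewrite -ball_normE /ball_ /= nrE ltcR => xy; exists y.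
Qed.

End Norms.

Lemma cauchy_limit (R : realType) (V : completeNormedModType R[i])
    (u : nat -> V) :
  (forall e : R, 0 < e -> exists N, forall m n, (N <= m)%N -> (N <= n)%N ->
    nr (u m - u n) < e) ->
  exists l, forall e : R, 0 < e -> exists N, forall n, (N <= n)%N ->
    nr (l - u n) < e.
Proof.
move=> uC.
have ul : cvg (u @ \oo).
  apply: cauchy_cvg; apply: cauchy_exP => e /= e0.
  have er : e \is Num.real by exact: gtr0_real.
  have [|N uN] := uC (complex.Re e); first by rewrite -ltcR RRe_real.
  exists (u N); exists N => // n /= Nn.
  rewrite -ball_normE /ball_ /= nrE -[ltRHS]RRe_real// ltcR.
  exact: uN.
exists (lim (u @ \oo)) => e e0; have eC : 0 < e%:C%C :> R[i] by rewrite ltcR.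
have /cvgrPdist_lt/(_ _ eC)[N _ uN] := ul; exists N => n Nn.
by have /= := uN n Nn; rewrite nrE ltcR.
Qed.

Section CStarBasics.
Variables (R : realType) (A : cstarAlgType R).
Implicit Types (a b c x y : A).

Lemma mul0c a : 0 ** a = 0.
Proof. by have := cmulZl 0 (0 : A) a; rewrite !scale0r. Qed.

Lemma mulc0 a : a ** 0 = 0.
Proof. by have := cmulZr 0 a (0 : A); rewrite !scale0r. Qed.

Lemma mulNc a b : (- a) ** b = - (a ** b).
Proof. by rewrite -scaleN1r cmulZl scaleN1r. Qed.

Lemma mulcN a b : a ** (- b) = - (a ** b).
Proof. by rewrite -scaleN1r cmulZr scaleN1r. Qed.

Lemma mulBc a b c : (a - b) ** c = a ** c - b ** c.
Proof. by rewrite cmulDl mulNc. Qed.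

Lemma mulcB a b c : a ** (b - c) = a ** b - a ** c.
Proof. by rewrite cmulDr mulcN. Qed.

Lemma mulc_suml (I : Type) (l : seq I) (F : I -> A) a :
  (\sum_(i <- l) F i) ** a = \sum_(i <- l) F i ** a.
Proof. by elim/big_rec2 : _ => [|i y x _ <-]; rewrite ?mul0c// cmulDl. Qed.

Lemma mulc_sumr (I : Type) (l : seq I) (F : I -> A) a :
  a ** (\sum_(i <- l) F i) = \sum_(i <- l) a ** F i.
Proof. by elim/big_rec2 : _ => [|i y x _ <-]; rewrite ?mulc0// cmulDr. Qed.

Lemma cstar0 : cstar (0 : A) = 0.
Proof. by have := cstarZ 0 (0 : A); rewrite rmorph0 !scale0r. Qed.

Lemma cstarN a : cstar (- a) = - cstar a.
Proof. by rewrite -scaleN1r cstarZ rmorphN1 scaleN1r. Qed.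

Lemma cstarB a b : cstar (a - b) = cstar a - cstar b.
Proof. by rewrite cstarD cstarN. Qed.

Lemma nrM a b : nr (a ** b) <= nr a * nr b.
Proof. by rewrite -lecR rmorphM/= -!nrE normcM. Qed.

Lemma nr_cstarM a : nr (cstar a ** a) = nr a ^+ 2.
Proof. by apply: complexI; rewrite rmorphXn/= -!nrE cstar_identity. Qed.

Lemma nr_cstar a : nr (cstar a) = nr a.
Proof.
have le b : nr b <= nr (cstar b).
  have [->|/eqP/nr_gt0 b0] := eqVneq b 0; first by rewrite cstar0.
  by have := nrM (cstar b) b; rewrite nr_cstarM expr2 ler_pM2r.
by apply/eqP; rewrite eq_le le andbT -{2}[a]cstarK le.
Qed.

Lemma nr_proj a : is_projection a -> nr a <= 1.
Proof.
move=> [aT aa]; have [->|/eqP/nr_gt0 a0] := eqVneq a 0; first by rewrite nr0.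
by have := nr_cstarM a; rewrite aT aa expr2 => /eqP;
  rewrite -{1}[nr a]mulr1 (inj_eq (mulfI (lt0r_neq0 a0))) => /eqP <-.
Qed.

(** Replaces unitary invariance of the norm: a unitary 1 + v of a unitization is only seen through
    [x + v ** x], and its unitarity through an equality of such products. *)
Lemma nr_isometry a b : cstar a ** a = cstar b ** b -> nr a = nr b.
Proof.
move=> ab; have := nr_cstarM a; rewrite ab nr_cstarM => /eqP.
by rewrite eqrXn2 ?nr_ge0// => /eqP.
Qed.

End CStarBasics.

(** * Homomorphisms are contractive *)

Lemma exp_small (R : realType) (r e : R) : 0 <= r < 1 -> 0 < e ->
  exists N, forall n, (N <= n)%N -> r ^+ n < e.
Proof.
move=> /andP[r0 r1] e0.
have /cvgrPdist_lt/(_ _ e0)[N _ rN] : r ^+ n @[n --> \oo] --> 0.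
  by apply: cvg_expr; rewrite ger0_norm.
by exists N => n /rN /=; rewrite sub0r normrN ger0_norm// exprn_ge0.
Qed.

Lemma contractive_limit (R : realType) (V : completeNormedModType R[i])
    (u : nat -> V) (r : R) : 0 <= r < 1 ->
  (forall n, nr (u n.+2 - u n.+1) <= r * nr (u n.+1 - u n)) ->
  exists l, forall e : R, 0 < e -> exists N, forall n, (N <= n)%N ->
    nr (l - u n) < e.
Proof.
move=> r01 ur; have /andP[r0 r1] := r01; apply: cauchy_limit => e e0.
have step n : nr (u n.+1 - u n) <= r ^+ n * nr (u 1 - u 0).
  elim: n => [|n IH]; first by rewrite mul1r.
  by rewrite (le_trans (ur n))// exprS -mulrA ler_wpM2l.
set c := nr (u 1 - u 0) in step.
have c0 : 0 <= c by exact: nr_ge0.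
have far n k : nr (u (n + k)%N - u n) * (1 - r) <= r ^+ n * c.
  (* With the difference of powers on the right, the induction on [k] telescopes. *)
  suff : nr (u (n + k)%N - u n) * (1 - r) <= (r ^+ n - r ^+ (n + k)) * c.
    move=> /le_trans; apply; rewrite ler_wpM2r// gerBl exprn_ge0//.
  elim: k => [|k IH]; first by rewrite addn0 !subrr nr0 !mul0r.
  rewrite addnS; have := nrBB (u (n + k)%N) (u (n + k).+1) (u n).
  rewrite -(ler_pM2r (_ : 0 < 1 - r)) ?subr_gt0// => /le_trans; apply.
  rewrite mulrDl (exprS r (n + k)).
  have : nr (u (n + k).+1 - u (n + k)%N) * (1 - r) <=
    r ^+ (n + k) * c * (1 - r).
    by rewrite ler_wpM2r ?step// subr_ge0 ltW.
  by move: IH; lra.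
have [||N rN] := @exp_small _ r (e / 2 * (1 - r) / (c + 1)) => //.
  by rewrite divr_gt0// ?mulr_gt0 ?subr_gt0// ?divr_gt0// ltr_wpDl.
have near n : (N <= n)%N -> nr (u n - u N) < e / 2.
  move=> /subnKC <-; rewrite -(ltr_pM2r (_ : 0 < 1 - r)) ?subr_gt0//.
  apply: (le_lt_trans (far _ _)); have := rN N (leqnn N).
  rewrite ltr_pdivlMr ?ltr_wpDl// => /(le_lt_trans _); apply.
  by rewrite ler_wpM2l ?exprn_ge0// lerDl.
exists N => m n Nm Nn; apply: (le_lt_trans (nrBB (u N) _ _)).
by rewrite [nr (u N - _)]nrC [ltRHS](splitr e) ltrD ?near.
Qed.

Section CStarFacts.
Variables (R : realType) (A : cstarAlgType R).
Implicit Types (a b c g h k x y u : A).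

(* The limit [e] is [1 - sqrt (1 - h ^ 2)], without reference to a unit. *)
Lemma sqrt_exists h : cstar h = h -> nr h < 1 ->
  exists e, [/\ cstar e = e, e ** h = h ** e & e + e = h ** h + e ** e].
Proof.
move=> hT h1; have r0 := nr_ge0 h; set r := nr h in h1 r0 *.
pose half : R[i] := (2^-1 : R)%:C%C.
have nhalf x : nr (half *: x) = 2^-1 * nr x by rewrite nrZR.
have halfT : Num.conj half = half.
  by apply: conj_Creal; rewrite realE lecR; apply/orP; left.
have half2 x : half *: x + half *: x = x.
  by rewrite -scalerDl -rmorphD/= [_ + _](_ : _ = 1) ?scale1r//; lra.
(* Iterates of x -> (h^2 + x^2) / 2, which maps the ball of radius [r] into itself and is an
   [r]-contraction on it. *)
pose u := fix u n := if n is m.+1 then half *: (h ** h + u m ** u m) else 0.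
have ur n : nr (u n) <= r.
  elim: n => [|n IH] /=; first by rewrite nr0.
  have := nrD (h ** h) (u n ** u n); have := nrM h h; have := nrM (u n) (u n).
  by rewrite nhalf -/r; have := nr_ge0 (u n); nra.
have sqB x y : x ** x - y ** y = x ** (x - y) + (x - y) ** y.
  by rewrite mulcB mulBc addrA subrK.
have sqB_le x y : nr (x ** x - y ** y) <= (nr x + nr y) * nr (x - y).
  rewrite sqB; have := nrD (x ** (x - y)) ((x - y) ** y).
  by have := nrM x (x - y); have := nrM (x - y) y; lra.
have [||e ue] := @contractive_limit _ _ u r; first by rewrite r0.
  move=> n; have -> : u n.+2 - u n.+1 =
      half *: (u n.+1 ** u n.+1 - u n ** u n).
    rewrite [X in X - _]/= [X in _ - X]/= -scalerBr.
    by rewrite [X in X - (_ + u n ** u n)]addrC addrKA.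
  rewrite nhalf; have := sqB_le (u n.+1) (u n).
  by have := ur n; have := ur n.+1; have := nr_ge0 (u n.+1 - u n); nra.
have uT n : cstar (u n) = u n.
  elim: n => [|n IH] /=; first exact: cstar0.
  by rewrite cstarZ cstarD !cstarM IH hT halfT.
have uh n : u n ** h = h ** u n.
  elim: n => [|n IH] /=; first by rewrite mul0c mulc0.
  rewrite cmulZl cmulZr cmulDl cmulDr cmulA; congr (_ *: (_ + _)).
  by rewrite -cmulA IH cmulA IH cmulA.
exists e; split.
- apply/eqP; rewrite -subr_eq0; apply/eqP/nr_small => d d0.
  have [|N /(_ N (leqnn N)) uN] := ue (d / 2); first lra.
  have := nrBB (u N) (cstar e) e.
  by rewrite -{1}(uT N) -cstarB nr_cstar [nr (u N - e)]nrC; lra.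
- apply/eqP; rewrite -subr_eq0; apply/eqP/nr_small => d d0.
  have [|N /(_ N (leqnn N)) uN] := ue (d / 2); first lra.
  have -> : e ** h - h ** e = (e - u N) ** h - h ** (e - u N).
    by rewrite mulBc mulcB uh opprB addrC addrA subrK addrC.
  have := nrB ((e - u N) ** h) (h ** (e - u N)).
  have := nrM (e - u N) h; have := nrM h (e - u N); rewrite -/r.
  by have := nr_ge0 (e - u N); nra.
- apply/eqP; rewrite -subr_eq0; apply/eqP/nr_small => d d0.
  have e0 := nr_ge0 e; pose d' := d / (4 + nr e).
  have d'0 : 0 < d' by rewrite divr_gt0//; lra.
  have d'E : d' * (4 + nr e) = d by apply: divfK; apply: lt0r_neq0; lra.
  have [N uN] := ue d' d'0.
  have -> : e + e - (h ** h + e ** e) =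
      (e - u N.+1) + (e - u N.+1) + (u N ** u N - e ** e).
    have wE : u N.+1 + u N.+1 = h ** h + u N ** u N by exact: half2.
    rewrite [X in _ = X + _]addrACA -opprD wE !opprD -!addrA.
    by congr (_ + (_ + (_ + _))); rewrite addKr.
  have := nrD ((e - u N.+1) + (e - u N.+1)) (u N ** u N - e ** e).
  have := nrD (e - u N.+1) (e - u N.+1).
  have := sqB_le (u N) e; have := uN N (leqnn N); have := uN N.+1 (leqnSn N).
  by rewrite [nr (u N - e)]nrC; have := ur N; have := nr_ge0 (e - u N); nra.
Qed.

Lemma unitary_part k g : cstar k = k -> cstar g = g -> g ** k = k ** g ->
  g + g = k ** k + g ** g -> nr k <= 1.
Proof.
(* In a unitization, [1 + w = 1 - g - 'i k] is unitary. *)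
move=> kT gT gk gE; pose w : A := - ('i *: k) - g.
have wT : cstar w = 'i *: k - g.
  by rewrite /w cstarB cstarN cstarZ kT gT conjCi scaleNr opprK.
have ii x : 'i *: ('i *: x) = - x :> A by rewrite scalerA -expr2 sqrCi scaleN1r.
have wsum : w + cstar w = - (g + g).
  by rewrite wT /w addrACA addNr add0r opprD.
have ww : cstar w ** w = k ** k + g ** g.
  rewrite wT /w mulBc !mulcB !mulcN !cmulZl !cmulZr ii opprK gk opprB.
  by rewrite opprK addrACA addNr addr0.
have ww' : w ** cstar w = k ** k + g ** g.
  rewrite wT /w mulBc !mulcB !mulNc !cmulZl !cmulZr ii opprK gk !opprB.
  by rewrite opprK addrACA subrr addr0.
(* The hypothesis on [v] says (1 + v)^* (1 + v) = 1. *)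
have iso v x : cstar v ** v = - (v + cstar v) -> nr (x + v ** x) = nr x.
  move=> vv; apply: nr_isometry; rewrite cstarD cstarM cmulDl !cmulDr.
  rewrite -(cmulA _ _ (v ** x)) (cmulA (cstar v) v x) vv mulNc mulcN cmulDl
    cmulDr.
  by rewrite !cmulA opprD [in LHS](addrCA _ (- _)) subrr addr0 addrK.
(* The adjoint of the unitary minus the unitary is 2 i k. At [x = k] this yields 2 |k|^2 <= 2
   |k|. *)
have k2 x : nr ('i *: (k ** x) + 'i *: (k ** x)) <= 2 * nr x.
  have -> : 'i *: (k ** x) + 'i *: (k ** x) =
      (x + cstar w ** x) - (x + w ** x).
    rewrite opprD addrACA subrr add0r -mulBc wT /w opprB opprK addrA subrK.
    by rewrite cmulDl cmulZl.
  have i1 : nr (x + w ** x) = nr x by apply: iso; rewrite ww wsum opprK gE.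
  have i2 : nr (x + cstar w ** x) = nr x.
    by apply: iso; rewrite cstarK ww' (addrC _ w) wsum opprK gE.
  by have := nrB (x + cstar w ** x) (x + w ** x); rewrite i1 i2; lra.
have := k2 k; rewrite -mulr2n -scaler_nat scalerA nrZ -{1}kT nr_cstarM.
rewrite normrM normCi mulr1 normr_nat.
have -> : complex.Re (2 : R[i]) = 2 by rewrite -(rmorph_nat (real_complex R) 2).
have := nr_ge0 k; rewrite expr2 => k0 kk.
by nra.
Qed.

End CStarFacts.

Section StarHom.
Variables (R : realType) (A B : cstarAlgType R) (f : A -> B).
Hypothesis fP : star_hom f.

Lemma star_homD : {morph f : x y / x + y}.
Proof. by move=> x y; have := star_hom_linear fP 1 x y; rewrite !scale1r. Qed.

Lemma star_hom0 : f 0 = 0.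
Proof. by apply: (addrI (f 0)); rewrite -star_homD !addr0. Qed.

Lemma star_homZ k x : f (k *: x) = k *: f x.
Proof. by have := star_hom_linear fP k x 0; rewrite !addr0 star_hom0 addr0. Qed.

Lemma star_homN : {morph f : x / - x}.
Proof. by move=> x; rewrite -scaleN1r star_homZ scaleN1r. Qed.

Lemma star_homB : {morph f : x y / x - y}.
Proof. by move=> x y; rewrite star_homD star_homN. Qed.

Lemma star_hom_sum (I : Type) (l : seq I) (F : I -> A) :
  f (\sum_(i <- l) F i) = \sum_(i <- l) f (F i).
Proof.
by elim/big_rec2 : _ => [|i y x _ <-]; rewrite ?star_hom0 ?star_homD.
Qed.

(** The element [e] of [sqrt_exists] is carried by [f] to a witness for [unitary_part], so |f h| <=
    1 when h is self-adjoint with |h| < 1. Scaling and the C*-identity do the rest. *)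
Lemma star_hom_contractive a : nr (f a) <= nr a.
Proof.
have sa h : cstar h = h -> nr h < 1 -> nr (f h) <= 1.
  move=> hT /(sqrt_exists hT)[e [eT eh eE]].
  by apply: (@unitary_part _ _ _ (f e));
    rewrite -?(star_hom_cstar fP) -?(star_homM fP) -?star_homD ?hT ?eT ?eh ?eE.
suff : nr (f (cstar a ** a)) <= nr (cstar a ** a).
  rewrite (star_homM fP) (star_hom_cstar fP) !nr_cstarM.
  by rewrite ler_sqr ?nnegrE ?nr_ge0.
set h := cstar a ** a; have hT : cstar h = h by rewrite cstarM cstarK.
have [//|hf] := leP (nr (f h)) (nr h); have h0 := nr_ge0 h.
(* This scaling puts 1 strictly between [c * nr h] and [c * nr (f h)]. *)
pose c := 2 / (nr h + nr (f h)).
have c0 : 0 < c by rewrite divr_gt0//; lra.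
have cE : c * (nr h + nr (f h)) = 2 by apply: divfK; apply: lt0r_neq0; lra.
have := sa (c%:C%C *: h); rewrite star_homZ !(nrZR _ (ltW c0)) cstarZ hT.
have -> : Num.conj c%:C%C = c%:C%C :> R[i].
  by apply: conj_Creal; rewrite realE lecR ltW.
move=> /(_ erefl) sah; have ch1 : c * nr h < 1 by nra.
suff : nr h < nr h by rewrite ltxx.
by have := sah ch1; nra.
Qed.

End StarHom.

(** * Projections as extreme points *)

Section ExtremePoint.
Variables (R : realType) (A : cstarAlgType R).
Implicit Types (u x y : A).

Lemma nrZVn (n : nat) x : nr (n%:R^-1 *: x) = n%:R^-1 * nr x.
Proof.
rewrite -[in RHS]nrZR ?invr_ge0//; congr (nr (_ *: _)).
by rewrite fmorphV/= -(rmorph_nat (real_complex R)).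
Qed.

Lemma nrZn (n : nat) x : nr (n%:R *: x) = n%:R * nr x.
Proof.
by rewrite -[in RHS]nrZR//; congr (nr (_ *: _));
  rewrite -(rmorph_nat (real_complex R)).
Qed.

Definition cubic_comb u y (a b c d : R[i]) : A :=
  a *: u + b *: y + c *: (y ** y) + d *: (y ** y ** y).

Lemma cubic_combD u y a b c d a' b' c' d' :
  cubic_comb u y a b c d + cubic_comb u y a' b' c' d' =
  cubic_comb u y (a + a') (b + b') (c + c') (d + d').
Proof.
by rewrite /cubic_comb !scalerDl addrACA; congr (_ + _); rewrite addrACA;
  congr (_ + _); rewrite addrACA.
Qed.

Lemma cubic_combZ u y k a b c d :
  k *: cubic_comb u y a b c d = cubic_comb u y (k * a) (k * b) (k * c) (k * d).
Proof. by rewrite /cubic_comb !scalerDr !scalerA. Qed.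

Lemma cube_comb u y c : u ** u = u -> u ** y = y -> y ** u = y ->
  let v := u + c *: y in v ** v ** v =
  cubic_comb u y 1 (3 * c) (3 * c ^+ 2) (c ^+ 3).
Proof.
move=> uu uy yu v.
have vv : v ** v = u + (2 * c) *: y + c ^+ 2 *: (y ** y).
  rewrite /v cmulDl !cmulDr !cmulZl !cmulZr uu uy yu scalerA -expr2.
  by rewrite mulrDl mul1r scalerDl !addrA.
rewrite vv /v /cubic_comb !cmulDl !cmulDr !cmulZl !cmulZr uu uy yu.
have -> : 3 * c = c + 2 * c by ring.
have -> : 3 * c ^+ 2 = 2 * c * c + c ^+ 2 by ring.
by rewrite -(cmulA y y u) yu !scalerA -exprSr !scalerDl scale1r !addrA.
Qed.

Lemma nr_cube x : nr x <= 1 -> nr (x ** x ** x) <= 1.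
Proof.
have := nr_ge0 x; have := nr_ge0 (x ** x).
by have := nrM x x; have := nrM (x ** x) x; nra.
Qed.

(* Averaging [(u + w y) ^ 3] over a probability measure on the square with
   vertices [1], ['i], [-1], [-'i] whose second and third moments vanish and
   whose mean is [1/2]. *)
Lemma extreme_step u y : is_projection u -> cstar y = y -> u ** y = y ->
  y ** u = y -> nr (u + y) <= 1 -> nr (u - y) <= 1 ->
  nr (u + (3 / 2) *: y) <= 1.
Proof.
move=> [uT uu] yT uy yu up um; have u1 : nr u <= 1 by exact: nr_proj.
(* [u + y ** y] is the squared modulus of [u + k *: y] for k = i and k = -i, and it is the mean of
   (u + y)^2 and (u - y)^2. *)
have usq : u + y ** y = 2^-1 *: ((u + y) ** (u + y) + (u - y) ** (u - y)).
  have -> : (u + y) ** (u + y) + (u - y) ** (u - y) = 2%:R *: (u + y ** y).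
    rewrite !(cmulDl, cmulDr) !(mulNc, mulcN) opprK uu uy yu addrACA.
    rewrite (addrACA u y u) subrr addr0 (addrACA y) subrr add0r addrACA.
    by rewrite scaler_nat.
  by rewrite scalerA mulVf ?scale1r// pnatr_eq0.
have usq1 : nr (u + y ** y) <= 1.
  rewrite usq nrZVn; have := nrD ((u + y) ** (u + y)) ((u - y) ** (u - y)).
  have := nrM (u + y) (u + y); have := nrM (u - y) (u - y).
  by have := nr_ge0 (u + y); have := nr_ge0 (u - y); nra.
have ui (k : R[i]) : k * k = -1 -> Num.conj k = - k -> nr (u + k *: y) <= 1.
  move=> kk kT; rewrite -(@ler_sqr _ (nr _) 1) ?nnegrE ?nr_ge0// expr1n.
  rewrite -nr_cstarM cstarD cstarZ uT yT kT cmulDl !cmulDr !cmulZl !cmulZr.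
  by rewrite uu uy yu scalerA mulNr kk opprK scale1r scaleNr addrA addrK.
have ii : 'i * 'i = -1 :> R[i] by rewrite -expr2 sqrCi.
have i1 : nr (u + 'i *: y) <= 1 by apply: ui; rewrite ?conjCi.
have i2 : nr (u + (- 'i) *: y) <= 1.
  apply: ui; first by rewrite mulrNN.
  by rewrite rmorphN; congr (- _); exact: conjCi.
have mid (k : R[i]) : nr (u + k *: y) <= 1 ->
    nr (u + ((1 + k) / 2) *: y) <= 1.
  move=> k1; have -> : u + ((1 + k) / 2) *: y =
      2^-1 *: ((u + y) + (u + k *: y)).
    rewrite addrACA scalerDr -[u + u]mulr2n -(scaler_nat 2 u) scalerA.
    rewrite mulVf ?pnatr_eq0//.
    rewrite scale1r; congr (_ + _); rewrite -[X in _ = _ *: (X + _)]scale1r.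
    by rewrite -scalerDl scalerA mulrC.
  by rewrite nrZVn; have := nrD (u + y) (u + k *: y); lra.
have d1 := mid _ i1; have d2 := mid _ i2.
pose cube k := (u + k *: y) ** (u + k *: y) ** (u + k *: y).
(* The weights are 1/6 at 1, 1/12 at i and at -i, and 1/3 at each of the midpoints (1 + i)/2 and (1
   - i)/2. The mean 1/2 gets the binomial coefficient 3, whence 3/2. *)
have -> : u + (3 / 2) *: y = 6^-1 *: (cube 1 + 2^-1 *: (cube 'i + cube (- 'i))
    + 2 *: (cube ((1 + 'i) / 2) + cube ((1 - 'i) / 2))).
  rewrite /cube !cube_comb// !(cubic_combD, cubic_combZ).
  rewrite /cubic_comb [X in _ = X *: u + _ + _ + _](_ : _ = 1); last by field.
  rewrite [X in _ = _ + X *: y + _ + _](_ : _ = 3 / 2); last by field.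
  (* Since [field] treats ['i] as an indeterminate, the vanishing moments come out as multiples of 1
     + i^2. *)
  rewrite [X in _ = _ + _ + X *: _ + _](_ : _ = (1 + 'i ^+ 2)); last by field.
  rewrite [X in _ = _ + _ + _ + X *: _](_ : _ = (1 + 'i ^+ 2) / 4);
    last by field.
  by rewrite sqrCi subrr mul0r !scale0r !addr0 scale1r.
have c1 := nr_cube up; rewrite -[y]scale1r -/(cube 1) in c1.
have c2 := nr_cube i1; have c3 := nr_cube i2.
have c4 := nr_cube d1; have c5 := nr_cube d2.
rewrite -/(cube 'i) in c2; rewrite -/(cube (- 'i)) in c3.
rewrite -/(cube _) in c4; rewrite -/(cube _) in c5.
rewrite nrZVn; set z := cube 'i + _; set z' := cube (_ / _) + _.
have := nrD (cube 1 + 2^-1 *: z) (2 *: z'); have := nrD (cube 1) (2^-1 *: z).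
rewrite nrZVn (nrZn 2); have := nrD (cube 'i) (cube (- 'i)).
by have := nrD (cube ((1 + 'i) / 2)) (cube ((1 - 'i) / 2)); rewrite -/z -/z';
  lra.
Qed.

(** Iterating [extreme_step] keeps u + (3/2)^n y and u - (3/2)^n y in the unit ball, so |y| <= 2
    (2/3)^n for all n. *)
Lemma projection_extreme u y : is_projection u -> cstar y = y -> u ** y = y ->
  y ** u = y -> nr (u + y) <= 1 -> nr (u - y) <= 1 -> y = 0.
Proof.
move=> uP yT uy yu up um; have u1 := nr_proj uP.
have iter n : nr (u + ((3 / 2) ^+ n) *: y) <=
  1 /\ nr (u - ((3 / 2) ^+ n) *: y) <= 1.
  elim: n => [|n [IHp IHm]]; first by rewrite scale1r.
  set z := (3 / 2) ^+ n *: y in IHp IHm.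
  have zT : cstar z = z.
    by rewrite cstarZ yT rmorphXn rmorphM fmorphV !rmorph_nat.
  have uz : u ** z = z by rewrite cmulZr uy.
  have zu : z ** u = z by rewrite cmulZl yu.
  rewrite exprS -scalerA -/z -scalerN; split; apply: extreme_step => //.
  - by rewrite cstarN zT.
  - by rewrite mulcN uz.
  - by rewrite mulNc zu.
  - by rewrite opprK.
have le2 n : nr y <= 2 * (2 / 3) ^+ n.
  have [h _] := iter n.
  have -> : y = (2 / 3) ^+ n *: ((u + (3 / 2) ^+ n *: y) - u).
    rewrite addrAC subrr add0r scalerA -exprMn [_ * _](_ : _ =
      1) ?expr1n ?scale1r//.
    by field.
  have -> : (2 / 3) ^+ n = ((2 / 3 : R) ^+ n)%:C%C :> R[i].
    by rewrite rmorphXn rmorphM/= fmorphV/= !rmorph_nat.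
  rewrite nrZR ?exprn_ge0// mulrC ler_wpM2r ?exprn_ge0//.
  by have := nrB (u + (3 / 2) ^+ n *: y) u; lra.
apply: nr_small => e e0.
have [||N /(_ N (leqnn N)) rN] := @exp_small R (2 / 3) (e / 2); [lra|lra|].
by have := le2 N; lra.
Qed.

End ExtremePoint.

(** * Sums of projections and ideals *)

Section Projections.
Variables (R : realType) (A : cstarAlgType R).
Implicit Types (a b u x y : A).

Lemma nr_compl q x : is_projection q -> nr (x - q ** x) <= nr x.
Proof.
move=> [qT qq]; set z := q ** x.
have zx : cstar z ** x = cstar z ** z.
  by rewrite /z cstarM qT -!cmulA [q ** (q ** x)]cmulA qq.
have xz : cstar x ** z = cstar z ** z by rewrite -zx /z cstarM qT cmulA.
(* [1 - 2 q] is a unitary, and [1 - q] is its mean with [1] *)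
have zz : nr (x - z - z) = nr x.
  apply: nr_isometry; rewrite !cstarB !(mulBc, mulcB) zx xz.
  by rewrite !subrr !sub0r !opprK !subrK.
have := nrD (x - z - z) x; rewrite zz.
have -> : x - z - z + x = 2%:R *: (x - z).
  by rewrite scaler_nat mulr2n addrAC -[LHS]addrA.
by rewrite nrZn; lra.
Qed.

(** For [u = q i], the order relation u Q u <= u would force the compressions u (q k) u with k != i
    to vanish. Here norm bounds replace the order: |u Q u| <= 1 and |u - x k| <= 1 place u + x j / N
    and u - x j / N in the unit ball, of which [u] is extreme in its corner. *)
Lemma orthogonal_of_sum (I : eqType) (l : seq I) (q : I -> A) i j :
  uniq l -> i \in l -> j \in l -> i != j ->
  (forall k, k \in l -> is_projection (q k)) ->
  is_projection (\sum_(k <- l) q k) -> q j ** q i = 0.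
Proof.
move=> ul il jl ij qP QP; set u := q i; set Q := \sum_(k <- l) q k in QP.
have uP : is_projection u by exact: qP.
have [uT uu] := uP; have u1 := nr_proj uP.
pose x k := u ** q k ** u.
have xE k : k \in l -> x k = cstar (q k ** u) ** (q k ** u).
  move=> /qP[kT kk]; rewrite cstarM kT uT /x -!cmulA.
  by rewrite (cmulA (q k) (q k)) kk.
have ux k : k \in l -> nr (u - x k) <= 1.
  move=> kl; have [kT kk] := qP k kl.
  have -> : u - x k = cstar (u - q k ** u) ** (u - q k ** u).
    rewrite cstarB mulBc !mulcB -xE// cstarM kT uT uu.
    by rewrite -/(x k) subrr subr0 cmulA.
  rewrite nr_cstarM expr_le1 ?nr_ge0//.
  exact: (le_trans (nr_compl _ (qP k kl))).
pose l' := [seq k <- l | (k != i) && (k != j)].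
have perm : perm_eq l (i :: j :: l').
  apply: uniq_perm => //=; first rewrite inE negb_or ij !mem_filter eqxx /=.
    by rewrite eqxx andbF filter_uniq.
  move=> k; rewrite !inE mem_filter.
  by have [->|] := eqVneq k i => //; have [->|] := eqVneq k j.
have uQu : u ** Q ** u = u + x j + \sum_(k <- l') x k.
  rewrite /Q (perm_big _ perm)/= !big_cons !cmulDr !cmulDl addrA uu uu.
  by rewrite mulc_sumr mulc_suml.
(* One unit of norm for each index in [l'], and one more for [u ** Q ** u] or for [u - x j]. *)
pose N := (size l').+1.
have NR : N%:R = (size l')%:R + 1 :> R by rewrite natr1.
have NE : N%:R *: u + x j = u ** Q ** u + \sum_(k <- l') (u - x k).
  rewrite uQu sumrB -addrA (addrCA (\sum_(k <- l') x k)) subrr addr0 addrAC.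
  by rewrite big_const_seq count_predT iter_addr_0 -mulrS scaler_nat.
have sum1 : nr (\sum_(k <- l') (u - x k)) <= (size l')%:R.
  apply: (le_trans (nr_sum _ _)); rewrite big_seq.
  apply: (le_trans (ler_sum _ (G := fun=> 1) _)).
    by move=> k; rewrite mem_filter => /andP[_ /ux].
  by rewrite -big_seq big_const_seq count_predT iter_addr_0.
have N1 : nr (N%:R *: u + x j) <= N%:R.
  rewrite NE; have := nrD (u ** Q ** u) (\sum_(k <- l') (u - x k)).
  have := nrM (u ** Q) u; have := nrM u Q; have := nr_proj QP.
  have := nr_ge0 u; have := nr_ge0 Q; have := nr_ge0 (u ** Q).
  by rewrite NR; nra.
have N2 : nr (N%:R *: u - x j) <= N%:R.
  have -> : N%:R *: u - x j = (size l')%:R *: u + (u - x j).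
    by rewrite /N -natr1 scalerDl scale1r addrA.
  have := nrD ((size l')%:R *: u) (u - x j); have := ux j jl.
  have : 0 <= (size l')%:R :> R by [].
  rewrite nrZn NR; move: u1 (nr_ge0 u); set n := _%:R.
  by nra.
have N0 : N%:R != 0 :> R[i] by rewrite pnatr_eq0.
have Nx0 : N%:R^-1 *: x j = 0.
  have ups y : nr (N%:R *: u + y) <= N%:R -> nr (u + N%:R^-1 *: y) <= 1.
    move=> uy; have -> : u + N%:R^-1 *: y = N%:R^-1 *: (N%:R *: u + y).
      by rewrite scalerDr scalerA mulVf ?scale1r.
    by rewrite nrZVn -ler_pdivlMl ?invr_gt0 ?ltr0n// invrK mulr1.
  apply: (projection_extreme uP).
  - rewrite cstarZ fmorphV rmorph_nat; congr (_ *: _).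
    by have [jT _] := qP j jl; rewrite /x !cstarM uT jT cmulA.
  - by rewrite cmulZr /x !cmulA uu.
  - by rewrite cmulZl /x -!cmulA uu.
  - exact: ups.
  - by rewrite -scalerN; apply: ups.
have xj0 : x j = 0.
  by rewrite -[x j]scale1r -(mulfV N0) -scalerA Nx0 scaler0.
by apply: nr0_eq0; apply/eqP; rewrite -sqrf_eq0 -nr_cstarM -xE// xj0 nr0.
Qed.

(** In the corner of [p], the compression of [k] is p - r with |r| < 1. Instead of inverting it, one
    notes that p - r^n is in [K] for all n and tends to [p]. *)
Lemma ideal_approx_proj (K : set A) p k : closed_ideal K -> is_projection p ->
  K k -> nr (p - k) < 1 -> K p.
Proof.
move=> KI pP Kk pk1; have [pT pp] := pP; have p1 := nr_proj pP.
pose r := p - p ** k ** p.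
have pr : p ** r = r by rewrite mulcB !cmulA !pp.
have rp : r ** p = r by rewrite mulBc -!cmulA !pp cmulA.
have Kpr : K (p - r).
  by rewrite opprB addrCA subrr addr0; apply: (Defs.idealMr KI);
    exact: (Defs.idealMl KI).
have r1 : nr r < 1.
  have -> : r = p ** (p - k) ** p by rewrite mulcB mulBc pp pp.
  have := nrM (p ** (p - k)) p; have := nrM p (p - k).
  by have := nr_ge0 p; have := nr_ge0 (p - k); have := nr_ge0 (p ** (p - k));
    nra.
have KB a b : K a -> K b -> K (a - b).
  by move=> Ka Kb; rewrite -scaleN1r; apply: (Defs.idealD KI) => //;
    exact: (Defs.idealZ KI).
apply: (closed_approx (ideal_closed KI)) => e e0.
have [||N /(_ N (leqnn N)) rN] := @exp_small R (nr r) e => //.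
  by rewrite nr_ge0.
exists (p - iter N (cmul r) p).
  elim: {rN}N => [|n IH] /=; first by rewrite subrr; exact: (Defs.ideal0 KI).
  have -> : p - r ** iter n (cmul r) p = (p - r) + r ** (p - iter n (cmul r) p).
    by rewrite mulcB rp addrA subrK.
  by apply: (Defs.idealD KI) => //; exact: (Defs.idealMl KI).
rewrite opprB addrCA subrr addr0; apply: le_lt_trans rN.
elim: N => [|n IH] //=; apply: (le_trans (nrM _ _)).
by rewrite exprS ler_wpM2l ?nr_ge0.
Qed.

Lemma perp_ideal (K : set A) : closed_ideal K -> closed_ideal (perp K).
Proof.
move=> KI; split.
- by move=> x _; rewrite mul0c mulc0.
- by move=> a b Ka Kb x Kx; have [[ax xa] [bx xb]] := (Ka x Kx, Kb x Kx);
    rewrite cmulDl cmulDr ax xa bx xb addr0.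
- by move=> k a Ka x Kx; have [ax xa] := Ka x Kx;
    rewrite cmulZl cmulZr ax xa scaler0.
- move=> a b Kb x Kx; rewrite -cmulA (Kb x Kx).1 mulc0.
  by rewrite cmulA (Kb _ (Defs.idealMr KI a Kx)).2.
- move=> a b Ka x Kx; rewrite cmulA (Ka x Kx).2 mul0c.
  by rewrite -cmulA (Ka _ (Defs.idealMl KI b Kx)).1.
- apply: approx_closed => a aK x Kx.
  have e_small (e : R) : 0 < e -> exists2 y, perp K y & nr (a - y) * nr x < e.
    move=> e0; have x0 := nr_ge0 x.
    have [|y Ky ay] := aK (e / (1 + nr x)); first by rewrite divr_gt0//; lra.
    exists y => //; move: ay; rewrite ltr_pdivlMr; last lra.
    by have := nr_ge0 (a - y); nra.
  split; apply: nr_small => e /e_small[y Ky ay]; have [yx xy] := Ky x Kx;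
    apply: le_lt_trans ay.
    have -> : a ** x = (a - y) ** x by rewrite mulBc yx subr0.
    exact: nrM.
  have -> : x ** a = x ** (a - y) by rewrite mulcB xy subr0.
  by rewrite mulrC; exact: nrM.
Qed.

End Projections.

Lemma star_hom_preim_ideal (R : realType) (A B : cstarAlgType R) (f : A -> B)
    (K : set B) :
  star_hom f -> closed_ideal K -> closed_ideal (f @^-1` K).
Proof.
move=> fP KI; split; rewrite /preimage/=.
- by rewrite star_hom0//; exact: (Defs.ideal0 KI).
- by move=> a b Ka Kb; rewrite star_homD//; exact: (Defs.idealD KI).
- by move=> k a Ka; rewrite star_homZ//; exact: (Defs.idealZ KI).
- by move=> a b Kb; rewrite (star_homM fP); exact: (Defs.idealMl KI).
- by move=> a b Ka; rewrite (star_homM fP); exact: (Defs.idealMr KI).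
- apply: approx_closed => a aK;
  apply: (closed_approx (ideal_closed KI)) => e e0.
  have [y Ky ay] := aK e e0; exists (f y) => //.
  by rewrite -star_homB//; exact: le_lt_trans (star_hom_contractive fP _) ay.
Qed.

Lemma idealI (R : realType) (A : cstarAlgType R) (K L : set A) :
  closed_ideal K -> closed_ideal L -> closed_ideal (K `&` L).
Proof.
move=> KI LI; split.
- by split; [exact: (Defs.ideal0 KI)|exact: (Defs.ideal0 LI)].
- by move=> a b [? ?] [? ?]; split; exact: idealD.
- by move=> k a [? ?]; split; exact: idealZ.
- by move=> a b [? ?]; split; exact: idealMl.
- by move=> a b [? ?]; split; exact: Defs.idealMr.
- by apply: closedI; exact: ideal_closed.
Qed.

Lemma star_hom_ext (R : realType) (A B : cstarAlgType R) (f g : A -> B)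
    (X : set A) :
  star_hom f -> star_hom g -> generates X -> (forall x, X x -> f x = g x) ->
  f =1 g.
Proof.
move=> fP gP Xgen fg; suff : [set x | f x = g x] = setT.
  by move=> S x; have : [set: A] x by []; rewrite -S.
apply: Xgen => //; first split => /=.
- by rewrite !star_hom0.
- by move=> a b ea eb; rewrite !star_homD// ea eb.
- by move=> k a ea; rewrite !star_homZ// ea.
- by move=> a b ea eb; rewrite (star_homM fP) (star_homM gP) ea eb.
- by move=> a ea; rewrite (star_hom_cstar fP) (star_hom_cstar gP) ea.
apply: approx_closed => a aP; apply/eqP; rewrite -subr_eq0; apply/eqP/nr_small.
move=> e e0; have [|y ye ay] := aP (e / 2); first lra.
have := nrBB (f y) (f a) (g a); rewrite {2}ye -!star_homB//.
have := star_hom_contractive fP (a - y);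
  have := star_hom_contractive gP (y - a).
by rewrite [nr (y - a)]nrC; lra.
Qed.

(** * The Hilbert space of square-summable families *)

Section AbsSquare.
Variable R : realType.
Implicit Types (z w : R[i]).

Definition absq z : R := complex.Re z ^+ 2 + complex.Im z ^+ 2.

Lemma absqE z : (absq z)%:C%C = Num.conj z * z.
Proof.
by rewrite mulrC -normCK normc_def -rmorphXn/= sqr_sqrtr// addr_ge0 ?sqr_ge0.
Qed.

Lemma absq_ge0 z : 0 <= absq z.
Proof. by rewrite addr_ge0 ?sqr_ge0. Qed.

Lemma absq0 : absq 0 = 0.
Proof. by rewrite /absq/= expr0n addr0. Qed.

Lemma absq_eq0 z : absq z = 0 -> z = 0.
Proof.
move=> z0; have := absqE z; rewrite z0 => /esym/eqP.
by rewrite mulf_eq0 conjC_eq0 orbb => /eqP.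
Qed.

Lemma absqM z w : absq (z * w) = absq z * absq w.
Proof. by apply: complexI; rewrite rmorphM/= !absqE rmorphM/=; ring. Qed.

Lemma parallelogram z w :
  absq (z + w) + absq (z - w) = 2 * (absq z + absq w).
Proof. by case: z w => [a b] [c d]; rewrite /absq/=; ring. Qed.

End AbsSquare.

Section SquareSummable.
Variables (R : realType) (X : choiceType).
Implicit Types (f g : X -> R[i]) (F G : {fset X}).

Definition sumsq f F : R := \sum_(x <- F) absq (f x).

Definition l2 : {pred (X -> R[i])} :=
  fun f => `[< exists M, forall F, sumsq f F <= M >].

Lemma l2P f : reflect (exists M, forall F, sumsq f F <= M) (f \in l2).
Proof. exact: asboolP. Qed.

Lemma sumsq_ge0 f F : 0 <= sumsq f F.
Proof. by apply: sumr_ge0 => x _; exact: absq_ge0. Qed.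

Lemma sumsqD f g F : sumsq (f + g) F <= 2 * (sumsq f F + sumsq g F).
Proof.
rewrite -big_split/= mulr_sumr; apply: ler_sum => x _.
by rewrite -parallelogram lerDl absq_ge0.
Qed.

Lemma sumsqZ (k : R[i]) f F : sumsq (k *: f) F = absq k * sumsq f F.
Proof. by rewrite mulr_sumr; apply: eq_bigr => x _; rewrite -absqM. Qed.

Lemma l2_submod_closed : submod_closed l2.
Proof.
split; first by apply/l2P; exists 0 => F; rewrite /sumsq big1// => x _;
  exact: absq0.
move=> k f g /l2P[M fM] /l2P[N gN]; apply/l2P.
exists (2 * (absq k * M + N)) => F; apply: (le_trans (sumsqD _ _ _)).
by rewrite ler_wpM2l// lerD// sumsqZ ler_wpM2l// absq_ge0.
Qed.

HB.instance Definition _ := GRing.isSubmodClosed.Build _ _ l2 l2_submod_closed.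

Record ell2 := Ell2 { ell2_val :> X -> R[i]; _ : ell2_val \in l2 }.

HB.instance Definition _ := [isSub for ell2_val].
HB.instance Definition _ := [Choice of ell2 by <:].
HB.instance Definition _ := [SubChoice_isSubLmodule of ell2 by <:].


Lemma sumsq_le f F G : (F `<=` G)%fset -> sumsq f F <= sumsq f G.
Proof.
move=> FG; rewrite /sumsq [leRHS](bigID (mem F))/= -[X in _ <= X + _]big_filter.
rewrite [X in _ <= X + _](perm_big (enum_fset F))/=.
  by rewrite lerDl sumr_ge0// => x _; exact: absq_ge0.
apply: uniq_perm; rewrite ?filter_uniq// => x; rewrite mem_filter andb_idr//.
exact: (fsubsetP FG).
Qed.

Definition energy (f : ell2) : R := sup (range (sumsq f)).

Lemma energy_sup (f : ell2) : has_sup (range (sumsq f)).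
Proof.
split; first by exists (sumsq f fset0), fset0.
by have /l2P[M fM] := valP f; exists M => _ [F _ <-].
Qed.

Lemma energy_ub (f : ell2) F : sumsq f F <= energy f.
Proof. by apply: sup_upper_bound; [exact: energy_sup|exists F]. Qed.

Lemma energy_le (f : ell2) M : (forall F, sumsq f F <= M) -> energy f <= M.
Proof.
move=> fM; apply: ge_sup; first by exists (sumsq f fset0), fset0.
by move=> _ [F _ <-].
Qed.

Lemma energy_ge0 (f : ell2) : 0 <= energy f.
Proof. exact: le_trans (sumsq_ge0 f fset0) (energy_ub _ _). Qed.

Lemma energy_adherent (f : ell2) (e : R) : 0 < e ->
  exists F, energy f - e < sumsq f F.
Proof.
by move=> e0; have [_ [F _ <-] ?] := sup_adherent e0 (energy_sup f); exists F.
Qed.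

(** Convergence along the finite subsets of [X] directed by inclusion: unordered summation when [u]
    is a partial sum. *)
Definition fset_lim (u : {fset X} -> R[i]) (l : R[i]) : Prop :=
  forall e : R, 0 < e -> exists F, forall G, (F `<=` G)%fset ->
    `|u G - l| < e%:C%C.

Lemma fset_lim_unique u l l' : fset_lim u l -> fset_lim u l' -> l = l'.
Proof.
move=> ul ul'; apply/eqP; rewrite -subr_eq0 -normr_eq0 normc_def.
set d := Num.sqrt _; have dE : `|l - l'| = d%:C%C by rewrite normc_def.
have [//|d0] := eqVneq d%:C%C 0.
have {}d0 : 0 < d by rewrite lt0r sqrtr_ge0 andbT; apply: contra_neq d0 => ->.
have [|F uF] := ul (d / 2); first lra.
have [|G uG] := ul' (d / 2); first lra.
have := ler_distD (u (F `|` G)%fset) l l'; rewrite dE (distrC l).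
have := ltrD (uF _ (fsubsetUl F G)) (uG _ (fsubsetUr F G)).
move=> /[swap] /le_lt_trans /[apply].
by rewrite -rmorphD/= -splitr ltxx.
Qed.

Lemma fset_limD u v l m : fset_lim u l -> fset_lim v m ->
  fset_lim (fun F => u F + v F) (l + m).
Proof.
move=> ul vm e e0.
have [|F uF] := ul (e / 2); first lra.
have [|G vG] := vm (e / 2); first lra.
exists (F `|` G)%fset => H; rewrite fsubUset => /andP[FH GH].
rewrite opprD addrACA (splitr e) rmorphD/=.
by rewrite (le_lt_trans (ler_normD _ _))// ltrD ?uF ?vG.
Qed.

Lemma fset_limZ k u l : fset_lim u l -> fset_lim (fun F => k * u F) (k * l).
Proof.
move=> ul e e0; pose c : R := complex.Re `|k|.
have cE : `|k| = c%:C%C by rewrite /c RRe_real// realE normr_ge0.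
have c0 : 0 <= c by rewrite -lecR -cE normr_ge0.
have [|F uF] := ul (e / (c + 1)); first by rewrite divr_gt0//; lra.
exists F => G /uF; rewrite -mulrBr normrM cE => h.
have lt : c%:C%C * (e / (c + 1))%:C%C < e%:C%C :> R[i].
  rewrite -rmorphM/= ltcR mulrA ltr_pdivrMr; last lra.
  by nra.
by apply: le_lt_trans lt; apply: ler_wpM2l; [rewrite lecR|exact: ltW].
Qed.

Lemma fset_lim_conj u l : fset_lim u l ->
  fset_lim (fun F => Num.conj (u F)) (Num.conj l).
Proof.
move=> ul e /ul[F uF]; exists F => G /uF.
by rewrite -rmorphB norm_conjC.
Qed.

Lemma energy_lim (f : ell2) : fset_lim (fun F =>
  (sumsq f F)%:C%C) (energy f)%:C%C.
Proof.
move=> e e0; have [F fF] := energy_adherent f e0; exists F => G FG.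
rewrite -rmorphB/= normc_def/= expr0n addr0 sqrtr_sqr ltcR distrC.
rewrite ger0_norm ?subr_ge0 ?energy_ub//.
by have := sumsq_le f FG; move: fF; lra.
Qed.

(** Polarization, conjugate linear in the first argument. The energies exist as suprema, so the
    definition needs no convergence; algebraic rules are transferred from finite sums through
    [ip_lim]. *)
Definition ip (f g : ell2) : R[i] :=
  4^-1 * ((energy (f + g))%:C%C + (-1) * (energy (f - g))%:C%C
   + 'i * (energy (f - 'i *: g))%:C%C
   + (- 'i) * (energy (f + 'i *: g))%:C%C).

Lemma ip_lim (f g : ell2) :
  fset_lim (fun F => \sum_(x <- F) Num.conj (f x) * g x) (ip f g).
Proof.
have pol F : \sum_(x <- F) Num.conj (f x) * g x =
    4^-1 * ((sumsq (f + g : ell2) F)%:C%C + (-1) * (sumsq (f - g : ell2) F)%:C%C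
   + 'i * (sumsq (f - 'i *: g : ell2) F)%:C%C
   + (- 'i) * (sumsq (f + 'i *: g : ell2) F)%:C%C).
  rewrite !rmorph_sum/= !mulr_sumr -!big_split/= mulr_sumr.
  apply: eq_bigr => x _; rewrite !absqE.
  have fD (u v : X -> R[i]) y : (u + v) y = u y + v y by [].
  have fN (u : X -> R[i]) y : (- u) y = - u y by [].
  have fZ k (u : X -> R[i]) y : (k *: u) y = k * u y by [].
  rewrite !(fD, fN, fZ).
  rewrite !rmorphD !rmorphN !rmorphM/=.
  have -> : Num.conj 'i = - 'i :> R[i] by exact: conjCi.
  set a := f x; set b := g x; set a' := Num.conj a; set b' := Num.conj b.
  rewrite [RHS](_ : _ = a' * b + 2^-1 * (1 + 'i ^+ 2) * (b' * a - a' * b)).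
    by rewrite sqrCi subrr mulr0 mul0r addr0.
  by field.
move=> e e0; have [F hF] := (fset_limZ 4^-1 (fset_limD (fset_limD (fset_limD
  (energy_lim (f + g)) (fset_limZ (-1) (energy_lim (f - g))))
  (fset_limZ 'i (energy_lim (f - 'i *: g))))
  (fset_limZ (- 'i) (energy_lim (f + 'i *: g))))) e e0.
by exists F => G FG; rewrite pol; exact: hF.
Qed.

End SquareSummable.

Lemma complete_of_balls (R : realType) (V : normedModType R[i]) :
  (forall F : set_system V, ProperFilter F ->
    (forall e : R, 0 < e -> exists g, F [set h | nr (g - h) < e]) ->
    exists l, forall e : R, 0 < e -> F [set h | nr (l - h) < e]) ->
  forall F : set_system V, ProperFilter F -> cauchy F -> cvg F.
Proof.
move=> VP F FF Fc; have [|l Fl] := VP F FF.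
  move=> e e0; have eC : 0 < e%:C%C :> R[i] by rewrite ltcR.
  have /cauchyP/(_ _ eC)[g Fg] := Fc; exists g; apply: filterS Fg => h.
  by rewrite -ball_normE /ball_/= nrE ltcR.
apply: (cvgP l) => B /nbhs_ballP[e /= e0 Be].
have er : e \is Num.real by exact: gtr0_real.
have : 0 < complex.Re e by rewrite -ltcR RRe_real.
move=> /Fl; apply: filterS => h /= lh; apply: Be;
  rewrite -ball_normE /ball_/= nrE.
by rewrite -[ltRHS]RRe_real// ltcR.
Qed.

Section InnerProduct.
Variables (R : realType) (X : choiceType).
Local Notation H := (ell2 R X).
Implicit Types (f g h : H).

Lemma fset_lim_ext (u v : {fset X} -> R[i]) l : u =1 v ->
  fset_lim u l -> fset_lim v l.
Proof. by move=> uv ul e /ul[F uF]; exists F => G /uF; rewrite uv. Qed.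

Lemma ipDr f g h : ip f (g + h) = ip f g + ip f h.
Proof.
apply: (fset_lim_unique (ip_lim f (g + h))).
apply: fset_lim_ext (fset_limD (ip_lim f g) (ip_lim f h)) => F.
by rewrite -big_split/=; apply: eq_bigr => x _; rewrite -mulrDr.
Qed.

Lemma ipZr k f g : ip f (k *: g) = k * ip f g.
Proof.
apply: (fset_lim_unique (ip_lim f (k *: g))).
apply: fset_lim_ext (fset_limZ k (ip_lim f g)) => F.
by rewrite mulr_sumr/=; apply: eq_bigr => x _; rewrite mulrCA.
Qed.

Lemma ip_conj f g : Num.conj (ip f g) = ip g f.
Proof.
apply: (fset_lim_unique (fset_lim_conj (ip_lim f g))).
apply: fset_lim_ext (ip_lim g f) => F.
by rewrite rmorph_sum/=; apply: eq_bigr => x _; rewrite rmorphM/= conjCK mulrC.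
Qed.

Lemma ipff f : ip f f = (energy f)%:C%C.
Proof.
apply: (fset_lim_unique (ip_lim f f)).
apply: fset_lim_ext (energy_lim f) => F.
by rewrite rmorph_sum/=; apply: eq_bigr => x _; rewrite absqE.
Qed.

Lemma ipDl f g h : ip (f + g) h = ip f h + ip g h.
Proof. by rewrite -ip_conj ipDr rmorphD/= !ip_conj. Qed.

Lemma ipZl k f g : ip (k *: f) g = Num.conj k * ip f g.
Proof. by rewrite -ip_conj ipZr rmorphM/= !ip_conj. Qed.

Lemma ipBr f g h : ip f (g - h) = ip f g - ip f h.
Proof. by rewrite ipDr -scaleN1r ipZr mulN1r. Qed.

Lemma ipBl f g h : ip (f - g) h = ip f h - ip g h.
Proof. by rewrite -ip_conj ipBr rmorphB/= !ip_conj. Qed.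

Lemma energyZ k f : energy (k *: f) = absq k * energy f.
Proof.
by apply: complexI; rewrite -ipff ipZl ipZr ipff mulrA -absqE rmorphM.
Qed.

Lemma energyD f g : energy (f + g) =
  energy f + energy g + 2 * complex.Re (ip f g).
Proof.
have : ip (f + g) (f + g) =
    (ip f f + ip f g) + (Num.conj (ip f g) + ip g g).
  by rewrite ipDl (ipDr f f g) (ipDr g f g) ip_conj.
rewrite !ipff; move: (ip f g) => [a b] /(congr1 (@complex.Re _)) /= ->.
by ring.
Qed.

Lemma energy_coord f x : absq (f x) <= energy f.
Proof.
by have := energy_ub f [fset x]%fset; rewrite /sumsq big_seq_fset1.
Qed.

Lemma energy_eq0 f : energy f = 0 -> f = 0.
Proof.
move=> f0; apply: val_inj; apply/funext => x; apply: absq_eq0.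
by apply/eqP; rewrite eq_le absq_ge0 andbT -f0 energy_coord.
Qed.

Lemma cauchy_schwarz f g : absq (ip f g) <= energy f * energy g.
Proof.
set a := absq _; have a0 : 0 <= a := absq_ge0 _.
have [g0|g0] := eqVneq (energy g) 0.
  have -> : a = 0; last by rewrite g0 mulr0.
  by rewrite /a (energy_eq0 g0) -(scale0r 0) ipZr mul0r absq0.
have {}g0 : 0 < energy g by rewrite lt0r g0 energy_ge0.
pose t := (energy g)^-1;
  have tg : t * energy g = 1 by rewrite mulVf// lt0r_neq0.
have t0 : 0 < t by rewrite invr_gt0.
(* The vector is [f] minus its orthogonal projection onto [g]. *)
have := energy_ge0 (f + (- t%:C%C * Num.conj (ip f g)) *: g).
have kE : - t%:C%C * Num.conj (ip f g) * ip f g = (- t * a)%:C%C.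
  by rewrite -mulrA -absqE -rmorphN -rmorphM.
rewrite energyD energyZ ipZr kE absqM /=.
have -> : absq (- t%:C%C) = t ^+ 2 by rewrite /absq/= sqrrN oppr0 expr0n addr0.
have -> : absq (Num.conj (ip f g)) = a.
  by apply: complexI; rewrite !absqE conjCK mulrC.
have -> : t ^+ 2 * a * energy g = t * a.
  by rewrite mulrAC expr2 -(mulrA t t) tg mulr1.
have aE : a = t * a * energy g by rewrite mulrAC tg mul1r.
by move=> ?; rewrite [leLHS]aE ler_wpM2r ?energy_ge0//; lra.
Qed.

Definition ell2_norm f : R[i] := (Num.sqrt (energy f))%:C%C.

Lemma Re_le_sqrt_absq (z : R[i]) : complex.Re z <= Num.sqrt (absq z).
Proof.
have [z0|/ltW z0] := leP 0 (complex.Re z);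
  last exact: le_trans z0 (sqrtr_ge0 _).
by rewrite -[leLHS](ger0_norm z0) -sqrtr_sqr ler_wsqrtr// lerDl sqr_ge0.
Qed.

Lemma ell2_normD f g : ell2_norm (f + g) <= ell2_norm f + ell2_norm g.
Proof.
rewrite /ell2_norm -rmorphD/= lecR; have f0 := energy_ge0 f;
  have g0 := energy_ge0 g.
rewrite -[leRHS]ger0_norm ?addr_ge0 ?sqrtr_ge0// -sqrtr_sqr ler_wsqrtr//.
rewrite sqrrD !sqr_sqrtr// energyD.
suff : complex.Re (ip f g) <= Num.sqrt (energy f) * Num.sqrt (energy g) by lra.
apply: (le_trans (Re_le_sqrt_absq _)); rewrite -sqrtrM//.
by rewrite ler_wsqrtr// cauchy_schwarz.
Qed.

Lemma ell2_normZ k f : ell2_norm (k *: f) = `|k| * ell2_norm f.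
Proof.
by rewrite /ell2_norm energyZ sqrtrM ?absq_ge0// rmorphM/= normc_def.
Qed.

Lemma ell2_norm_eq0 f : ell2_norm f = 0 -> f = 0.
Proof.
move=> /complexI f0; apply: energy_eq0; apply/eqP.
by rewrite eq_le energy_ge0 andbT -sqrtr_eq0 f0.
Qed.

HB.instance Definition _ := Lmodule_isNormed.Build R[i] H
  ell2_normD ell2_normZ ell2_norm_eq0.

Lemma energyE f : energy f = nr f ^+ 2.
Proof. by rewrite [nr f]/(Num.sqrt (energy f)) sqr_sqrtr// energy_ge0. Qed.

Lemma nr_coord f x : Num.sqrt (absq (f x)) <= nr f.
Proof. by rewrite ler_wsqrtr// energy_coord. Qed.

Lemma Re_coord f x : `|complex.Re (f x)| <= nr f.
Proof.
apply: le_trans (nr_coord f x).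
by rewrite -sqrtr_sqr ler_wsqrtr// lerDl sqr_ge0.
Qed.

Lemma Im_coord f x : `|complex.Im (f x)| <= nr f.
Proof.
apply: le_trans (nr_coord f x).
by rewrite -sqrtr_sqr ler_wsqrtr// lerDr sqr_ge0.
Qed.

Lemma nr_le_sumsq f (M : R) : 0 <= M -> (forall F, sumsq f F <= M ^+ 2) ->
  nr f <= M.
Proof.
move=> M0 fM; rewrite -(@ler_sqr _ (nr f)) ?nnegrE ?nr_ge0// -energyE.
exact: energy_le.
Qed.

(** The real and imaginary parts of the coordinates are 1-Lipschitz, so they converge along [F].
    Bounds on finite partial sums pass to the limit, which shows both that the limit is
    square-summable and that it is a limit in norm. *)
Lemma ell2_complete (F : set_system H) : ProperFilter F -> cauchy F -> cvg F.
Proof.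
move: F; apply: complete_of_balls => F FF Fc.
have real_lim (p : H -> R) : (forall f g, `|p f - p g| <= nr (f - g)) ->
    exists l : R, p x @[x --> F] --> l.
  move=> pL; suff pc : cvg (p x @[x --> F]) by exists (lim (p x @[x --> F])).
  apply: cauchy_cvg; apply: cauchy_exP => e e0.
  have [g Fg] := Fc e e0; exists (p g).
  suff : F [set h | ball (p g) e (p h)] by [].
  apply: filterS Fg => h /= gh; rewrite -ball_normE /ball_/=.
  exact: le_lt_trans (pL _ _) gh.
have /choice[a aP] : forall x, exists l : R, complex.Re ((f : H) x) @[f --> F]
  --> l.
  move=> x; apply: (real_lim (fun f => complex.Re (f x))) => f g.
  have -> : complex.Re (f x) - complex.Re (g x) = complex.Re (f x - g x).
    by case: (f x) (g x) => [? ?] [? ?].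
  exact: Re_coord (f - g) x.
have /choice[b bP] : forall x, exists l : R, complex.Im ((f : H) x) @[f --> F]
  --> l.
  move=> x; apply: (real_lim (fun f => complex.Im (f x))) => f g.
  have -> : complex.Im (f x) - complex.Im (g x) = complex.Im (f x - g x).
    by case: (f x) (g x) => [? ?] [? ?].
  exact: Im_coord (f - g) x.
pose L : X -> R[i] := fun x => (a x +i* b x)%C.
have cvg_ext (u v : H -> R) (l : R) : u =1 v ->
    u h @[h --> F] --> l -> v h @[h --> F] --> l by move=> /funext ->.
have LP g (e : R) : 0 < e -> F [set h | nr (g - h) < e] ->
    forall G, sumsq (L - g) G <= e ^+ 2.
  move=> e0 Fg G.
  have cv (r : seq X) : \sum_(x <- r) absq ((h : H) x - g x) @[h --> F] -->
      \sum_(x <- r) absq (L x - g x).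
    elim: r => [|x r IH].
      rewrite big_nil; apply: (cvg_ext (fun=> 0)); last exact: cvg_cst.
      by move=> h; rewrite big_nil.
    rewrite big_cons; have cvx : absq ((h : H) x - g x) @[h --> F] -->
        absq (L x - g x).
      have absqB (z w : R[i]) : absq (z - w) =
          (complex.Re z - complex.Re w) * (complex.Re z - complex.Re w) +
          (complex.Im z - complex.Im w) * (complex.Im z - complex.Im w).
        by case: z w => [? ?] [? ?]; rewrite /absq/= !expr2.
      have cR : complex.Re ((h : H) x) - complex.Re (g x) @[h --> F] -->
          a x - complex.Re (g x) by apply: cvgB (aP x) (cvg_cst _).
      have cI : complex.Im ((h : H) x) - complex.Im (g x) @[h --> F] -->
          b x - complex.Im (g x) by apply: cvgB (bP x) (cvg_cst _).
      rewrite absqB; apply: cvg_ext (cvgD (cvgM cR cR) (cvgM cI cI)) => h.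
      by rewrite absqB.
    by apply: cvg_ext (cvgD cvx IH) => h; rewrite big_cons.
  apply: (cvgr_to_le (cv (enum_fset G))); apply: filterS Fg => h /= gh.
  apply: (@le_trans _ _ (energy (h - g))); first exact: energy_ub (h - g) G.
  by rewrite energyE nrC ler_sqr ?nnegrE ?nr_ge0// ltW.
have Ll2 : L \in @l2 R X.
  have [g Fg] := Fc 1 ltr01; rewrite -[L](subrK (g : X -> R[i])).
  apply: rpredD; last exact: valP g.
  by apply/l2P; exists (1 ^+ 2); exact: LP.
exists (Ell2 Ll2) => e e0; have e20 : 0 < e / 2 by lra.
have [g Fg] := Fc _ e20.
have Lg : nr (Ell2 Ll2 - g) <= e / 2.
  by apply: nr_le_sumsq; [exact: ltW|exact: LP].
by apply: filterS Fg => h /= gh; apply: (le_lt_trans (nrBB g _ _)); lra.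
Qed.

HB.instance Definition _ := Uniform_isComplete.Build H ell2_complete.

End InnerProduct.

(** * Bounded operators *)

Section BoundedOperators.
Variables (R : realType) (X : choiceType).
Local Notation H := (ell2 R X).
Implicit Types (f g h : H).

Lemma norm_ip f g : `|ip f g| <= (nr f * nr g)%:C%C.
Proof.
rewrite normc_def lecR -[leRHS]ger0_norm ?mulr_ge0 ?nr_ge0// -sqrtr_sqr.
by rewrite ler_wsqrtr// exprMn -!energyE cauchy_schwarz.
Qed.

Lemma ip_real_le f g (r : R) : ip f g = r%:C%C -> r <= nr f * nr g.
Proof.
move=> fg; have := norm_ip f g; rewrite fg normc_def/= expr0n addr0 sqrtr_sqr.
by rewrite lecR; apply: le_trans; exact: ler_norm.
Qed.

Lemma ip_ext f g : (forall h, ip h f = ip h g) -> f = g.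
Proof.
move=> fg; apply/eqP; rewrite -subr_eq0; apply/eqP/energy_eq0/complexI.
by rewrite -ipff ipBr fg subrr.
Qed.

Definition adjoint (T S : H -> H) := forall f g, ip (T f) g = ip f (S g).

Definition bounded_by (T : H -> H) (M : R) :=
  0 <= M /\ forall f, nr (T f) <= M * nr f.

Lemma adjoint_sym (T S : H -> H) : adjoint T S -> adjoint S T.
Proof. by move=> TS f g; rewrite -ip_conj -TS ip_conj. Qed.

Lemma adjoint_unique (T S S' : H -> H) : adjoint T S -> adjoint T S' -> S = S'.
Proof.
by move=> TS TS'; apply/funext => g; apply: ip_ext => f; rewrite -TS TS'.
Qed.

Lemma adjoint_bounded (T S : H -> H) M : adjoint T S -> bounded_by T M ->
  bounded_by S M.
Proof.
move=> TS [M0 TM]; split=> // g.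
have /ip_real_le : ip (T (S g)) g = (nr (S g) ^+ 2)%:C%C.
  by rewrite TS ipff energyE.
have := TM (S g); have := nr_ge0 g; have := nr_ge0 (S g).
have [->|Sg0] := eqVneq (nr (S g)) 0.
  by move=> *; rewrite mulr_ge0// nr_ge0.
move=> S0 g0 TSg SgT; have {}S0 : 0 < nr (S g) by rewrite lt0r Sg0.
rewrite -(ler_pM2l S0) -expr2 (le_trans SgT)//.
by rewrite mulrA (mulrC _ M) ler_wpM2r.
Qed.

(** Linearity follows from the existence of an adjoint ([bop_additive], [bop_scalable]). Asking for
    the adjoint outright avoids the Riesz representation theorem. *)
Definition bop_pred : {pred (H -> H)} :=
  fun T => `[< (exists M, bounded_by T M) /\ exists S, adjoint T S >].

Lemma bop_predP (T : H -> H) :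
  reflect ((exists M, bounded_by T M) /\ exists S, adjoint T S) (T \in
    bop_pred).
Proof. exact: asboolP. Qed.

Lemma adjointD (T S T' S' : H -> H) : adjoint T S -> adjoint T' S' ->
  adjoint (T + T') (S + S').
Proof.
by move=> TS TS' f g; rewrite [LHS]ipDl [RHS]ipDr TS TS'.
Qed.

Lemma adjointZ k (T S : H -> H) : adjoint T S ->
  adjoint (k *: T) (Num.conj k *: S).
Proof. by move=> TS f g; rewrite [LHS]ipZl [RHS]ipZr TS. Qed.

Lemma bounded_byD (T S : H -> H) M N : bounded_by T M -> bounded_by S N ->
  bounded_by (T + S) (M + N).
Proof.
move=> [M0 TM] [N0 SN]; split=> [|f]; first by rewrite addr_ge0.
by rewrite mulrDl (le_trans (nrD (T f) (S f)))// lerD.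
Qed.

Lemma bounded_byZ k (T : H -> H) M : bounded_by T M ->
  bounded_by (k *: T) (complex.Re `|k| * M).
Proof.
have k0 : 0 <= complex.Re `|k| by rewrite normc_def sqrtr_ge0.
move=> [M0 TM]; split=> [|f]; first by rewrite mulr_ge0.
by rewrite -mulrA [nr _]nrZ ler_wpM2l.
Qed.

Lemma bop_submod_closed : submod_closed bop_pred.
Proof.
split.
  apply/bop_predP; split.
    by exists 0; split=> // f; rewrite mul0r [nr _]nr0.
  by exists 0 => f g; rewrite -[LHS]/(ip 0 g) -[RHS]/(ip f 0)
    -(scale0r 0) ipZl ipZr rmorph0 !mul0r.
move=> k T S /bop_predP[[M TM] [T' TT']] /bop_predP[[N SN] [S' SS']].
apply/bop_predP; split.
  by exists (complex.Re `|k| * M + N); apply: bounded_byD => //;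
    exact: bounded_byZ.
by exists (Num.conj k *: T' + S'); apply: adjointD => //; exact: adjointZ.
Qed.

HB.instance Definition _ :=
  GRing.isSubmodClosed.Build _ _ bop_pred bop_submod_closed.

Record bop := Bop { bop_val :> H -> H; _ : bop_val \in bop_pred }.

HB.instance Definition _ := [isSub for bop_val].
HB.instance Definition _ := [Choice of bop by <:].
HB.instance Definition _ := [SubChoice_isSubLmodule of bop by <:].

Implicit Types (T S : bop).

Lemma bop_ext T S : (forall f, T f = S f) -> T = S.
Proof. by move=> TS; apply: val_inj; apply/funext. Qed.

Lemma bop_bounded T : exists M, bounded_by T M.
Proof. by have /bop_predP[] := valP T. Qed.

Lemma bop_adjoint T : exists S : bop, adjoint T S.
Proof.
have /bop_predP[[M TM] [S TS]] := valP T.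
have SP : S \in bop_pred.
  apply/bop_predP; split; last by exists T; exact: adjoint_sym.
  by exists M; exact: adjoint_bounded TM.
by exists (Bop SP).
Qed.

Definition bop_star T : bop := sval (cid (bop_adjoint T)).

Lemma bop_starP T : adjoint T (bop_star T).
Proof. exact: svalP (cid (bop_adjoint T)). Qed.

Lemma bop_star_eq T S : adjoint T S -> bop_star T = S.
Proof.
by move=> TS; apply: val_inj; exact: adjoint_unique (bop_starP T) TS.
Qed.

Lemma bop_additive T f g : T (f + g) = T f + T g.
Proof.
by apply: ip_ext => h; rewrite ipDr -!(adjoint_sym (bop_starP T)) ipDr.
Qed.

Lemma bop_scalable T k f : T (k *: f) = k *: T f.
Proof.
by apply: ip_ext => h; rewrite ipZr -!(adjoint_sym (bop_starP T)) ipZr.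
Qed.

Lemma bop_mul_subproof T S : (T \o S : H -> H) \in bop_pred.
Proof.
apply/bop_predP; split; last first.
  by exists (bop_star S \o bop_star T) => f g /=; rewrite bop_starP bop_starP.
have [M [M0 TM]] := bop_bounded T; have [N [N0 SN]] := bop_bounded S.
exists (M * N); split=> [|f]; first by rewrite mulr_ge0.
by rewrite (le_trans (TM _))// -mulrA ler_wpM2l.
Qed.

Definition bop_mul T S : bop := Bop (bop_mul_subproof T S).

Definition onorm T : R := inf [set M | bounded_by T M].

Lemma onorm_inf T : has_inf [set M | bounded_by T M].
Proof.
split; first by have [M TM] := bop_bounded T; exists M.
by exists 0 => M [].
Qed.

Lemma onorm_le T M : 0 <= M -> (forall f, nr (T f) <= M * nr f) -> onorm T <= M.
Proof. by move=> M0 TM; apply: inf_lbound; [exact: (onorm_inf T).2|split]. Qed.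

Lemma onorm_ge0 T : 0 <= onorm T.
Proof. by apply: lb_le_inf; [exact: (onorm_inf T).1|move=> M []]. Qed.

Lemma onormP T f : nr (T f) <= onorm T * nr f.
Proof.
have [f0|f0] := eqVneq (nr f) 0.
  have [M [_ /(_ f)]] := bop_bounded T.
  by rewrite f0 !mulr0.
have {}f0 : 0 < nr f by rewrite lt0r f0 nr_ge0.
rewrite -ler_pdivrMr//; apply: lb_le_inf; first exact: (onorm_inf T).1.
by move=> M [_ /(_ f)]; rewrite ler_pdivrMr.
Qed.

Lemma onorm_bounded T : bounded_by T (onorm T).
Proof. by split; [exact: onorm_ge0|exact: onormP]. Qed.

Lemma onormD T S : onorm (T + S) <= onorm T + onorm S.
Proof.
by have [? ?] := bounded_byD (onorm_bounded T) (onorm_bounded S);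
  apply: onorm_le.
Qed.

Lemma onormZ k T : onorm (k *: T) = complex.Re `|k| * onorm T.
Proof.
have le c S : onorm (c *: S) <= complex.Re `|c| * onorm S.
  by have [? ?] := bounded_byZ c (onorm_bounded S); apply: onorm_le.
apply/eqP; rewrite eq_le; apply/andP; split; first exact: le.
have [->|k0] := eqVneq k 0; first by rewrite normr0 mul0r onorm_ge0.
have := le k^-1 (k *: T); rewrite scalerA mulVf// scale1r normrV ?unitfE//.
have nk : 0 < complex.Re `|k| by rewrite -ltcR RRe_real ?realE ?normr_ge0//
  normr_gt0.
have -> : complex.Re `|k|^-1 = (complex.Re `|k|)^-1.
  have {1}-> : `|k| = (complex.Re `|k|)%:C%C.
    by rewrite RRe_real// realE normr_ge0.
  by rewrite -fmorphV.
by rewrite mulrC ler_pdivlMr// mulrC.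
Qed.

Lemma onorm_eq0 T : onorm T = 0 -> T = 0.
Proof.
move=> T0; apply: bop_ext => f; apply: nr0_eq0; apply/eqP.
by rewrite eq_le nr_ge0 andbT (le_trans (onormP T f))// T0 mul0r.
Qed.

Definition bop_norm T : R[i] := (onorm T)%:C%C.

Lemma bop_normD T S : bop_norm (T + S) <= bop_norm T + bop_norm S.
Proof. by rewrite /bop_norm -rmorphD/= lecR onormD. Qed.

Lemma bop_normZ k T : bop_norm (k *: T) = `|k| * bop_norm T.
Proof.
by rewrite /bop_norm onormZ -[in RHS](RRe_real (ger0_real (normr_ge0 k)))
  -rmorphM.
Qed.

Lemma bop_norm_eq0 T : bop_norm T = 0 -> T = 0.
Proof. by move=> /complexI/onorm_eq0. Qed.

HB.instance Definition _ := Lmodule_isNormed.Build R[i] bop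
  bop_normD bop_normZ bop_norm_eq0.

Lemma onormE T : nr T = onorm T.
Proof. by []. Qed.

Lemma onorm_star_le T : onorm (bop_star T) <= onorm T.
Proof.
have [? ?] := adjoint_bounded (bop_starP T) (onorm_bounded T).
exact: onorm_le.
Qed.

Lemma bop_starK T : bop_star (bop_star T) = T.
Proof. by apply: bop_star_eq; apply: adjoint_sym; exact: bop_starP. Qed.

Lemma bop_starD T S : bop_star (T + S) = bop_star T + bop_star S.
Proof. by apply: bop_star_eq; apply: adjointD; exact: bop_starP. Qed.

Lemma bop_starZ k T : bop_star (k *: T) = Num.conj k *: bop_star T.
Proof. by apply: bop_star_eq; apply: adjointZ; exact: bop_starP. Qed.

Lemma bop_starM T S : bop_star (bop_mul T S) =
  bop_mul (bop_star S) (bop_star T).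
Proof.
by apply: bop_star_eq => f g /=; rewrite bop_starP bop_starP.
Qed.

Lemma onormM T S : onorm (bop_mul T S) <= onorm T * onorm S.
Proof.
apply: onorm_le => [|f]; first by rewrite mulr_ge0 ?onorm_ge0.
by rewrite (le_trans (onormP T _))// -mulrA ler_wpM2l ?onorm_ge0 ?onormP.
Qed.

Lemma onorm_star_mul T : onorm (bop_mul (bop_star T) T) = onorm T ^+ 2.
Proof.
apply/eqP; rewrite eq_le; apply/andP; split.
  by rewrite (le_trans (onormM _ _))// expr2 ler_wpM2r ?onorm_ge0
    ?onorm_star_le.
set c := onorm (bop_mul _ _); have c0 : 0 <= c by exact: onorm_ge0.
rewrite -(sqr_sqrtr c0) ler_sqr ?nnegrE ?onorm_ge0 ?sqrtr_ge0//.
apply: onorm_le => [|f]; first exact: sqrtr_ge0.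
rewrite -(@ler_sqr _ (nr _)) ?nnegrE ?nr_ge0 ?mulr_ge0 ?nr_ge0 ?sqrtr_ge0//.
have /ip_real_le : ip f (bop_mul (bop_star T) T f) = (nr (T f) ^+ 2)%:C%C.
  by rewrite -[LHS](bop_starP T) ipff energyE.
have := onormP (bop_mul (bop_star T) T) f; have := nr_ge0 f.
rewrite -/c exprMn (sqr_sqrtr c0) (expr2 (nr f)) => f0 cf /le_trans; apply.
by rewrite mulrCA ler_wpM2l.
Qed.

(** Pointwise limits exist for the operators and, as the involution does not increase the norm, for
    their adjoints. The second limit is an adjoint of the first, as membership in [bop] demands. *)
Lemma bop_complete (F : set_system bop) : ProperFilter F -> cauchy F -> cvg F.
Proof.
move: F; apply: complete_of_balls => F FF Fc.
have point_lim (p : bop ->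
  H) f : (forall T S, nr (p T - p S) <= nr (T - S) * nr f) ->
    exists l, forall e : R, 0 < e -> F [set T | nr (l - p T) < e].
  move=> pL; have f0 := nr_ge0 f; suff pc : cvg (p T @[T --> F]).
    exists (lim (p T @[T --> F])) => e e0.
    have eC : 0 < e%:C%C :> R[i] by rewrite ltcR.
    have /cvgrPdist_lt/(_ _ eC) := pc; apply: filterS => T /=.
    by rewrite nrE ltcR.
  apply: cauchy_cvg; apply: cauchy_exP => e /= e0.
  have er : e \is Num.real by exact: gtr0_real.
  have d0 : 0 < complex.Re e / (1 + nr f).
    by rewrite divr_gt0//; [rewrite -ltcR RRe_real|lra].
  have [T FT] := Fc _ d0; exists (p T).
  suff : F [set S | ball (p T) e (p S)] by [].
  have f1 : 0 < 1 + nr f by lra.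
  apply: filterS FT => S /=; rewrite ltr_pdivlMr// => TS.
  rewrite -ball_normE /ball_/= nrE -[ltRHS]RRe_real// ltcR.
  by have := pL T S; have := nr_ge0 (T - S); nra.
have /choice[L LP] : forall f, exists l, forall e : R, 0 < e ->
    F [set T : bop | nr (l - T f) < e].
  by move=> f; apply: (@point_lim (fun T => T f) f) => T S;
    exact: onormP (T - S) f.
have /choice[L' LP'] : forall f, exists l, forall e : R, 0 < e ->
    F [set T : bop | nr (l - bop_star T f) < e].
  move=> f; apply: (@point_lim (fun T => bop_star T f) f) => T S.
  have -> : bop_star T f - bop_star S f = bop_star (T - S) f.
    by rewrite bop_starD -(scaleN1r S) bop_starZ rmorphN1 scaleN1r.
  apply: (le_trans (onormP _ _)); rewrite ler_wpM2r ?nr_ge0//.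
  exact: onorm_star_le.
have LT T (e : R) : F [set S | nr (T - S) < e] ->
    forall f, nr (L f - T f) <= e * nr f.
  move=> FT f; apply/ler_addgt0Pr => d d0.
  have [S [/= TS fS]] := filter_ex (filterI FT (LP f d d0)).
  have STf : nr (S f - T f) <= nr (S - T) * nr f by exact: onormP (S - T) f.
  have := nrBB (S f) (L f) (T f); have := nr_ge0 f;
    rewrite [nr (S - T)]nrC in STf.
  have := ler_wpM2r (nr_ge0 f) (ltW TS); move: fS STf.
  by move: (nr _) (nr _) (nr _ * _) (nr _) => *; lra.
have LL' : adjoint L L'.
  move=> f g; apply/eqP; rewrite -subr_eq0; apply/eqP.
  set d := _ - _; apply: absq_eq0; apply/eqP.
  rewrite eq_le absq_ge0 andbT -sqrtr_eq0 eq_le sqrtr_ge0 andbT.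
  apply/ler_addgt0Pr => e e0; rewrite add0r -lecR -normc_def.
  have f0 := nr_ge0 f; have g0 := nr_ge0 g.
  pose c := e / (1 + nr f + nr g); have c0 : 0 < c by rewrite divr_gt0//; lra.
  have cE : c * (1 + nr f + nr g) = e by apply: divfK; apply: lt0r_neq0; lra.
  have [T [/= Lf Lg]] := filter_ex (filterI (LP f c c0) (LP' g c c0)).
  have -> : d = ip (L f - T f) g + ip f (bop_star T g - L' g).
    by rewrite ipBl ipBr (bop_starP T f g) addrA subrK.
  apply: (le_trans (ler_normD _ _)).
  apply: (le_trans (lerD (norm_ip _ _) (norm_ip _ _))).
  by rewrite -rmorphD/= lecR [nr (_ - L' g)]nrC; nra.
have LP1 : L \in bop_pred.
  apply/bop_predP; split; last by exists L'.
  have [T /LT LT1] := Fc 1 ltr01; exists (1 + onorm T).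
  split=> [|f]; first by rewrite addr_ge0 ?onorm_ge0.
  have := LT1 f; have := onormP T f; have := nrD (L f - T f) (T f).
  by rewrite subrK; lra.
exists (Bop LP1) => e e0; have e20 : 0 < e / 2 by lra.
have [T FT] := Fc _ e20.
have LTe : nr (Bop LP1 - T) <= e / 2.
  by apply: onorm_le; [exact: ltW|exact: LT].
by apply: filterS FT => S /= TS; apply: (le_lt_trans (nrBB T _ _)); lra.
Qed.

HB.instance Definition _ := Uniform_isComplete.Build bop bop_complete.

Lemma bop_mulA T S U : bop_mul T (bop_mul S U) = bop_mul (bop_mul T S) U.
Proof. by apply: bop_ext. Qed.

Lemma bop_mulDl T S U : bop_mul (T + S) U = bop_mul T U + bop_mul S U.
Proof. by apply: bop_ext. Qed.

Lemma bop_mulDr T S U : bop_mul T (S + U) = bop_mul T S + bop_mul T U.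
Proof. by apply: bop_ext => f; exact: (bop_additive T (S f) (U f)). Qed.

Lemma bop_mulZl k T S : bop_mul (k *: T) S = k *: bop_mul T S.
Proof. by apply: bop_ext. Qed.

Lemma bop_mulZr k T S : bop_mul T (k *: S) = k *: bop_mul T S.
Proof. by apply: bop_ext => f; exact: (bop_scalable T k (S f)). Qed.

Lemma bop_normM T S : `|bop_mul T S| <= `|T| * `|S|.
Proof. by rewrite !nrE -rmorphM/= lecR; exact: onormM. Qed.

Lemma bop_cstar_identity T : `|bop_mul (bop_star T) T| = `|T| ^+ 2.
Proof. by rewrite !nrE -rmorphXn/= !onormE onorm_star_mul. Qed.

HB.instance Definition _ := isCStarAlgebra.Build R bop
  bop_mulA bop_mulDl bop_mulDr bop_mulZl bop_mulZr
  bop_starK bop_starD bop_starZ bop_starM bop_normM bop_cstar_identity.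

End BoundedOperators.

(** * A representation with nonzero vertex projections *)

Section PartialShift.
Variables (R : realType) (X : choiceType).
Local Notation H := (ell2 R X).
Implicit Types (f : H) (g h : X -> option X).

Definition partial_inverse g h := forall x y, g y = Some x <-> h x = Some y.

Lemma partial_inverse_sym g h : partial_inverse g h -> partial_inverse h g.
Proof. by move=> gh x y; split=> /gh. Qed.

(** If [h] is the partial inverse of [g], this sends the basis vector at x to the one at h x, or to
    0 where [h] is undefined. *)
Definition shift_fun g (f : X -> R[i]) : X -> R[i] :=
  fun y => if g y is Some x then f x else 0.

Lemma shift_sumsq g h f F : partial_inverse g h ->
  sumsq (shift_fun g f) F <= energy f.
Proof.
move=> gh; have pmapE (r : seq X) :
    \sum_(y <- r) absq (shift_fun g f y) = \sum_(x <- pmap g r) absq (f x).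
  elim: r => [|y r IH]; first by rewrite !big_nil.
  rewrite big_cons IH /= /shift_fun; case: (g y) => [x|] /=.
    by rewrite big_cons.
  by rewrite absq0 add0r.
(* [g] is injective where it is defined, so its values on [F] are listed without repetition. *)
rewrite /sumsq pmapE; apply: le_trans (energy_ub f [fset x in pmap g F]%fset).
rewrite /sumsq (perm_big (enum_fset [fset x in pmap g F]%fset))//=.
apply: uniq_perm; rewrite ?fset_uniq//; last by move=> x; rewrite inE.
apply: (@pmap_uniq _ _ _ (fun x => odflt x (h x))); last exact: fset_uniq.
by move=> y; case gy: (g y) => [x|] //=; rewrite (gh x y).1.
Qed.

Lemma shift_l2 g h f : partial_inverse g h -> shift_fun g f \in @l2 R X.
Proof.
by move=> gh; apply/l2P; exists (energy f) => F; exact: shift_sumsq gh.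
Qed.

Definition shift g h (gh : partial_inverse g h) f : H := Ell2 (shift_l2 f gh).

Section Fixed.
Variables (g h : X -> option X) (gh : partial_inverse g h).
Let hg := partial_inverse_sym gh.

Lemma shift_linear k f f' :
  shift gh (f + k *: f') = shift gh f + k *: shift gh f'.
Proof.
apply: val_inj; apply/funext => y; rewrite /= /shift_fun.
transitivity (shift_fun g f y + k * shift_fun g f' y); last by [].
by rewrite /shift_fun; case: (g y) => [//|]; rewrite mulr0 addr0.
Qed.

Lemma shift_energy f : energy (shift gh f) <= energy f.
Proof. by apply: energy_le => F; exact: shift_sumsq gh. Qed.

Lemma shiftK f : shift gh (shift hg (shift gh f)) = shift gh f.
Proof.
apply: val_inj; apply/funext => y; rewrite /= /shift_fun.
by case gy: (g y) => [x|] //; rewrite (gh x y).1// gy.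
Qed.
End Fixed.

(* [shift gh] preserves the energies, hence by polarization the inner products,
   of the vectors in the range of the projection [P]. *)
Lemma shift_adjoint g h (gh : partial_inverse g h)
    (hg := partial_inverse_sym gh) : adjoint (shift gh) (shift hg).
Proof.
move=> f k; pose P u := shift hg (shift gh u);
  pose Q u := shift gh (shift hg u).
have PE u x : P u x = if h x is Some _ then u x else 0.
  rewrite /P /= /shift_fun; case hx: (h x) => [y|] //.
  by rewrite (gh x y).2.
have QE u y : Q u y = if g y is Some _ then u y else 0.
  rewrite /Q /= /shift_fun; case gy: (g y) => [x|] //.
  by rewrite (gh x y).1.
have ipQ u w : ip u (Q w) = ip (Q u) w.
  apply: (fset_lim_unique (ip_lim u (Q w))).
  apply: fset_lim_ext (ip_lim (Q u) w) => F; apply: eq_bigr => x _.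
  by rewrite !QE; case: (g x) => //; rewrite rmorph0 mul0r mulr0.
have ipP u w : ip u (P w) = ip (P u) w.
  apply: (fset_lim_unique (ip_lim u (P w))).
  apply: fset_lim_ext (ip_lim (P u) w) => F; apply: eq_bigr => x _.
  by rewrite !PE; case: (h x) => //; rewrite rmorph0 mul0r mulr0.
have en u : energy (shift gh u) = energy (P u).
  apply/eqP; rewrite eq_le shift_energy andbT.
  by rewrite -[in leLHS](shiftK gh u) shift_energy.
have Plin k' u w : P (u + k' *: w) = P u + k' *: P w.
  by rewrite /P !shift_linear.
have iso u w : ip (shift gh u) (shift gh w) = ip (P u) (P w).
  have add a b c : energy (shift gh a + c *: shift gh b) =
    energy (P a + c *: P b).
    by rewrite -shift_linear -Plin en.
  rewrite /ip; have := add u w 1; have := add u w (-1).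
  rewrite !scale1r !scaleN1r => -> ->; rewrite add.
  by have := add u w (- 'i); rewrite !scaleNr => ->.
have shQ : Q (shift gh f) = shift gh f by rewrite /Q shiftK.
have shP : P (shift hg k) = shift hg k.
  apply: val_inj; apply/funext => x.
  by rewrite -[LHS]/(P (shift hg k) x) PE /= /shift_fun; case: (h x).
by rewrite -[in LHS]shQ -ipQ /Q iso -ipP shP shP.
Qed.

Lemma shift_bop g h (gh : partial_inverse g h) : shift gh \in @bop_pred R X.
Proof.
apply/bop_predP; split; last first.
  by exists (shift (partial_inverse_sym gh)); exact: shift_adjoint.
exists 1; split=> // f; rewrite mul1r -ler_sqr ?nnegrE ?nr_ge0//.
by rewrite -!energyE shift_energy.
Qed.

Definition shift_op g h (gh : partial_inverse g h) : bop R X :=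
  Bop (shift_bop gh).

Lemma shift_op_star g h (gh : partial_inverse g h) :
  cstar (shift_op gh) = shift_op (partial_inverse_sym gh).
Proof. by apply: bop_star_eq; exact: shift_adjoint. Qed.

Lemma shift_opE g h (gh : partial_inverse g h) f y :
  shift_op gh f y = if g y is Some x then f x else 0.
Proof. by []. Qed.

Lemma bop_coord_ext (T S : bop R X) : (forall f y, T f y = S f y) -> T = S.
Proof.
move=> TS; apply: bop_ext => f; apply: val_inj; apply/funext => y; exact: TS.
Qed.

Lemma bop_sum_coord (I : Type) (l : seq I) (F : I -> bop R X) f y :
  (\sum_(i <- l) F i) f y = \sum_(i <- l) F i f y.
Proof.
elim: l => [|i l IH]; first by rewrite !big_nil.
by rewrite !big_cons -IH.
Qed.

End PartialShift.

Section GraphRepresentation.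
Variables (R : realType) (E : digraph).
Hypothesis Efin : row_finite E.
Local Notation X := (vertex E * nat)%type.

Definition edges_into v : seq (edge E) := fset_set (@rng E @^-1` [set v]).

Lemma mem_edges_into v e : (e \in edges_into v) = (rng e == v).
Proof.
have := in_fset_set (Efin v) e; rewrite /edges_into => ->.
by apply/idP/eqP => [/set_mem|ev]; [|apply: mem_set].
Qed.

Definition edge_deg (e : edge E) := size (edges_into (rng e)).
Definition edge_idx (e : edge E) := index e (edges_into (rng e)).

Lemma edge_idx_lt e : (edge_idx e < edge_deg e)%N.
Proof. by rewrite index_mem mem_edges_into. Qed.

Definition vertex_map v (y : X) : option X := if y.1 == v then Some y else None.

(* The edges [e] into a vertex of in-degree [d] share out the fibre over it
   according to residues modulo [d]. *)
Definition edge_out e (y : X) : option X :=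
  if (y.1 == rng e) && (y.2 %% edge_deg e == edge_idx e)%N
  then Some (src e, y.2 %/ edge_deg e)%N else None.

Definition edge_in e (x : X) : option X :=
  if x.1 == src e then Some (rng e, x.2 * edge_deg e + edge_idx e)%N else None.

Lemma vertex_mapP v : partial_inverse (vertex_map v) (vertex_map v).
Proof.
by move=> x y; rewrite /vertex_map; split; case: ifP => // /eqP v1 [<-];
  rewrite v1 eqxx.
Qed.

Lemma edge_mapP e : partial_inverse (edge_out e) (edge_in e).
Proof.
have lt := edge_idx_lt e; have d0 : (0 < edge_deg e)%N by apply: leq_trans lt.
move=> [u m] [w n]; rewrite /edge_out /edge_in /=; split.
  case: ifP => // /andP[/eqP -> /eqP <-] [<- <-].
  by rewrite eqxx -divn_eq.
case: ifP => // /eqP -> [<- <-]; rewrite eqxx modnMDl modn_small// eqxx /=.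
by rewrite divnMDl// divn_small// addn0.
Qed.

Definition rep_vertex v : bop R X := shift_op R (vertex_mapP v).
Definition rep_edge e : bop R X := shift_op R (edge_mapP e).

Lemma rep_vertexE v f y : rep_vertex v f y = if y.1 == v then f y else 0.
Proof. by rewrite /rep_vertex shift_opE /vertex_map; case: ifP. Qed.

Lemma rep_edgeE e f y : rep_edge e f y =
  if edge_out e y is Some x then f x else 0.
Proof. exact: shift_opE. Qed.

Lemma rep_edge_starE e f x : (cstar (rep_edge e) : bop R X) f x =
  if edge_in e x is Some y then f y else 0.
Proof. by rewrite /rep_edge shift_op_star shift_opE. Qed.

Lemma bop_mulE (T S : bop R X) f y : (T ** S) f y = T (S f) y.
Proof. by []. Qed.

Lemma rep_CK : CK_family rep_vertex rep_edge.
Proof.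
split.
- move=> v; split.
    rewrite /rep_vertex shift_op_star; apply: bop_coord_ext => f y.
    by rewrite !shift_opE.
  by apply: bop_coord_ext => f y; rewrite bop_mulE !rep_vertexE;
    case: (y.1 == v).
- move=> v w vw; apply: bop_coord_ext => f y.
  rewrite bop_mulE !rep_vertexE; case: ifP => // /eqP ->.
  by case: ifP => // /eqP.
- move=> e; apply: bop_coord_ext => f y; rewrite !bop_mulE !rep_edgeE.
  case ey: (edge_out e y) => [x|] //; rewrite rep_edge_starE.
  by rewrite (edge_mapP e x y).1// rep_edgeE ey.
- move=> e; apply: bop_coord_ext => f x.
  rewrite bop_mulE rep_edge_starE rep_vertexE.
  case ex: (edge_in e x) => [y|].
    rewrite rep_edgeE (edge_mapP e x y).2//.
    by move: ex; rewrite /edge_in; case: ifP.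
  by move: ex; rewrite /edge_in; case: ifP.
- move=> v [e0 e0v]; rewrite fsbig_finite; last exact: Efin.
  apply: bop_coord_ext => f y; rewrite rep_vertexE bop_sum_coord.
  rewrite -/(edges_into v).
  have term e : e \in edges_into v -> (rep_edge e ** cstar (rep_edge e)) f y =
      if (y.1 == v) && (y.2 %% size (edges_into v) == index e (edges_into v))%N
      then f y else 0.
    rewrite mem_edges_into => /eqP ev; rewrite bop_mulE rep_edgeE.
    case ey: (edge_out e y) => [x|].
      rewrite rep_edge_starE (edge_mapP e x y).1//.
      by move: ey; rewrite /edge_out /edge_deg /edge_idx ev; case: ifP.
    by move: ey; rewrite /edge_out /edge_deg /edge_idx ev; case: ifP.
  rewrite (eq_big_seq _ term); case: eqP => [yv|_]; last by rewrite big1.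
  have uv : uniq (edges_into v) by exact: fset_uniq.
  have s0 : (0 < size (edges_into v))%N.
    by rewrite -has_predT; apply/hasP; exists e0; rewrite // mem_edges_into;
      apply/eqP.
  (* The only edge into [v] whose range projection keeps the coordinate at [y]. *)
  pose e := nth e0 (edges_into v) (y.2 %% size (edges_into v)).
  have ein : e \in edges_into v by rewrite mem_nth// ltn_mod.
  rewrite (bigD1_seq e)//= index_uniq ?ltn_mod// eqxx.
  rewrite big_seq_cond big1 ?addr0// => e' /andP[e'in e'e]; case: eqP => // ye.
  by case/negP: e'e; rewrite /e ye nth_index.
Qed.

Lemma rep_vertex_neq0 v : rep_vertex v <> 0.
Proof.
pose d : X -> R[i] := fun y => if y == (v, 0%N) then 1 else 0.
have d1 : d (v, 0%N) = 1 by rewrite /d eqxx.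
have d0 y : y != (v, 0%N) -> absq (d y) = 0.
  by rewrite /d => /negPf ->; exact: absq0.
have dl2 : d \in @l2 R X.
  apply/l2P; exists 1 => F; rewrite /sumsq.
  have [vF|vF] := boolP ((v, 0%N) \in F).
    rewrite (bigD1_seq (v, 0%N) vF (fset_uniq F))/= big1; last by move=> y /d0.
    rewrite addr0 [leLHS](_ : _ = absq 1); last by rewrite -d1.
    by rewrite /absq/= expr1n expr0n addr0.
  rewrite big_seq big1 ?ler01// => y yF; apply: d0.
  by apply: contraNneq vF => <-.
move=> /(congr1 (fun T : bop R X => T (Ell2 dl2) (v, 0%N))).
rewrite rep_vertexE eqxx /= d1 => /eqP.
by rewrite oner_eq0.
Qed.

End GraphRepresentation.

Lemma graph_algebra_vertex_neq0 (R : realType) (E : digraph)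
    (A : cstarAlgType R) (p : vertex E -> A) (s : edge E -> A) v :
  row_finite E -> is_graph_algebra p s -> p v <> 0.
Proof.
move=> Efin [_ _ /(_ _ _ _ (rep_CK R Efin))[phi [phiP phip _]]] pv0.
have r0 := @rep_vertex_neq0 R E v; apply: r0.
by rewrite -phip pv0 star_hom0.
Qed.

(** * Paths and monomials *)

Section Paths.
Variable E : digraph.
Implicit Types (v w : vertex E) (e f : edge E) (mu nu : seq (edge E)).

Fixpoint path_from v mu : bool :=
  if mu is e :: mu' then (rng e == v) && path_from (src e) mu' else true.

Fixpoint path_end v mu : vertex E :=
  if mu is e :: mu' then path_end (src e) mu' else v.

Lemma path_from_cat v mu nu :
  path_from v (mu ++ nu) = path_from v mu && path_from (path_end v mu) nu.
Proof. by elim: mu v => //= e mu IH v; rewrite IH andbA. Qed.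

Lemma path_end_cat v mu nu :
  path_end v (mu ++ nu) = path_end (path_end v mu) nu.
Proof. by elim: mu v => //=. Qed.

End Paths.

(* A path is encoded with its range, which the edges do not determine when
   there are none. *)
Notation gpath E := (vertex E * seq (edge E))%type.

Section GPath.
Variable E : digraph.
Implicit Types (x y : gpath E).

Definition gvalid x := path_from x.1 x.2.
Definition gend x := path_end x.1 x.2.
Definition glen x : int := (size x.2)%:Z.
Definition gcat x mu : gpath E := (x.1, x.2 ++ mu).

Lemma gend_cat x mu : gend (gcat x mu) = path_end (gend x) mu.
Proof. exact: path_end_cat. Qed.

Lemma gvalid_cat x mu :
  gvalid (gcat x mu) = gvalid x && path_from (gend x) mu.
Proof. exact: path_from_cat. Qed.

Lemma glen_cat x mu : glen (gcat x mu) = glen x + (size mu)%:Z.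
Proof. by rewrite /glen size_cat PoszD. Qed.

End GPath.

(** * Linear spans *)

Section Span.
Variables (R : realType) (A : cstarAlgType R).
Implicit Types (P Q : A -> Prop) (a b : A).

Inductive lspan P : A -> Prop :=
| lspan0 : lspan P 0
| lspan_cons k a b : P a -> lspan P b -> lspan P (k *: a + b).

Lemma lspan_incl P a : P a -> lspan P a.
Proof.
by move=> Pa; rewrite -[a]scale1r -[_ *: _]addr0; apply: lspan_cons => //;
  exact: lspan0.
Qed.

Lemma lspanD P a b : lspan P a -> lspan P b -> lspan P (a + b).
Proof.
elim=> [|k c d Pc _ IH Pb]; first by rewrite add0r.
by rewrite -addrA; apply: lspan_cons => //; exact: IH.
Qed.

Lemma lspanZ P k a : lspan P a -> lspan P (k *: a).
Proof.
elim=> [|c x y Px _ IH]; first by rewrite scaler0; exact: lspan0.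
by rewrite scalerDr scalerA; exact: lspan_cons.
Qed.

Lemma lspan_sum P (I : eqType) (l : seq I) (F : I -> A) :
  (forall i, i \in l -> lspan P (F i)) -> lspan P (\sum_(i <- l) F i).
Proof.
elim: l => [|i l IH] lP; first by rewrite big_nil; exact: lspan0.
rewrite big_cons; apply: lspanD; first by apply: lP; rewrite inE eqxx.
by apply: IH => j jl; apply: lP; rewrite inE jl orbT.
Qed.

Lemma lspan_bind P Q a : (forall b, P b -> lspan Q b) -> lspan P a -> lspan Q a.
Proof.
move=> PQ; elim=> [|k x y Px _ IH]; first exact: lspan0.
by apply: lspanD => //; apply: lspanZ; exact: PQ.
Qed.

Lemma lspan_mull P Q c a : (forall b, P b -> lspan Q (c ** b)) ->
  lspan P a -> lspan Q (c ** a).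
Proof.
move=> PQ; elim=> [|k x y Px _ IH]; first by rewrite mulc0; exact: lspan0.
by rewrite cmulDr cmulZr; apply: lspanD => //; apply: lspanZ; exact: PQ.
Qed.

Lemma lspan_mulr P Q c a : (forall b, P b -> lspan Q (b ** c)) ->
  lspan P a -> lspan Q (a ** c).
Proof.
move=> PQ; elim=> [|k x y Px _ IH]; first by rewrite mul0c; exact: lspan0.
by rewrite cmulDl cmulZl; apply: lspanD => //; apply: lspanZ; exact: PQ.
Qed.

Lemma lspan_cstar P Q a : (forall b, P b -> lspan Q (cstar b)) ->
  lspan P a -> lspan Q (cstar a).
Proof.
move=> PQ; elim=> [|k x y Px _ IH]; first by rewrite cstar0; exact: lspan0.
by rewrite cstarD cstarZ; apply: lspanD => //; apply: lspanZ; exact: PQ.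
Qed.

Lemma lspan_eq0 P (f : A -> A) a : {morph f : x y / x + y} ->
  (forall k, {morph f : x / k *: x}) -> (forall b, P b -> f b = 0) ->
  lspan P a -> f a = 0.
Proof.
move=> fD fZ P0; elim=> [|k x y Px _ IH].
  by have := fZ 0 0; rewrite !scale0r.
by rewrite fD fZ P0// IH scaler0 addr0.
Qed.

End Span.

(** * Products of path elements and the dense graded subalgebra *)

Section PathElements.
Variables (R : realType) (E : digraph) (A : cstarAlgType R).
Variables (p : vertex E -> A) (s : edge E -> A).
Hypotheses (Efin : row_finite E) (CK : CK_family p s).
Implicit Types (v w : vertex E) (e f : edge E) (x y : gpath E).

Lemma CK_pp v : p v ** p v = p v.
Proof. by have [] := CK_proj CK v. Qed.

Lemma CK_pT v : cstar (p v) = p v.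
Proof. by have [] := CK_proj CK v. Qed.

Lemma CK_s_src e : s e ** p (src e) = s e.
Proof. by rewrite -(CK_src CK) cmulA; exact: (CK_pisom CK). Qed.

Lemma CK_range_proj e : is_projection (s e ** cstar (s e)).
Proof.
split; first by rewrite cstarM cstarK.
by rewrite cmulA; congr (_ ** _); exact: (CK_pisom CK).
Qed.

Lemma CK_rng_seq e : p (rng e) =
  \sum_(f <- fset_set (@rng E @^-1` [set rng e])) s f ** cstar (s f).
Proof. by rewrite (CK_rng CK) ?fsbig_finite//; exists e. Qed.

Lemma mem_rng_seq v e :
  (e \in fset_set (@rng E @^-1` [set v])) = (rng e == v).
Proof.
rewrite in_fset_set//.
by apply/idP/eqP => [/set_mem|ev]; [|apply: mem_set].
Qed.

(** The range projections of the edges into one vertex sum to a projection, so [orthogonal_of_sum]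
    applies to them; orthogonality passes to the partial isometries through s = s s^* s. *)
Lemma CK_edge_orth_rng e f : e != f -> rng e = rng f -> cstar (s e) ** s f = 0.
Proof.
move=> ef ref; have sum := CK_rng_seq e.
have := @orthogonal_of_sum R A _ _ (fun f => s f ** cstar (s f)) f e
  (fset_uniq (fset_set (@rng E @^-1` [set rng e]))).
rewrite !mem_rng_seq ref eqxx eq_sym ef -ref -sum => /(_ isT isT isT) h.
have {}h := h (fun k _ => CK_range_proj k) (CK_proj CK _).
have -> : cstar (s e) ** s f =
    cstar (s e) ** (s e ** cstar (s e) ** (s f ** cstar (s f))) ** s f.
  have sf := CK_pisom CK f; have se := CK_pisom CK e.
  rewrite -!cmulA [cstar (s f) ** s f](_ : _ = p (src f));
    last exact: (CK_src CK).
  rewrite CK_s_src !cmulA; congr (_ ** _).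
  by rewrite -{1}se !cstarM cstarK cmulA.
by rewrite h mulc0 mul0c.
Qed.

Lemma CK_p_s e : p (rng e) ** s e = s e.
Proof.
rewrite CK_rng_seq mulc_suml (bigD1_seq e) ?fset_uniq ?mem_rng_seq//=.
rewrite (CK_pisom CK) big_seq_cond big1 ?addr0// => f.
rewrite mem_rng_seq => /andP[/eqP fe nfe].
by rewrite -cmulA CK_edge_orth_rng ?mulc0// fe.
Qed.

Lemma CK_edge_orth e f : e != f -> cstar (s e) ** s f = 0.
Proof.
move=> ef; have [|/eqP ref] := eqVneq (rng e) (rng f);
  first exact: CK_edge_orth_rng.
rewrite -(CK_p_s e) -(CK_p_s f) cstarM CK_pT cmulA -[X in X ** _]cmulA.
by rewrite (CK_orth CK)// mulc0 mul0c.
Qed.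

Fixpoint Spath v (mu : seq (edge E)) : A :=
  if mu is e :: mu' then s e ** Spath (src e) mu' else p v.

Definition SS x := Spath x.1 x.2.

Lemma Spath_l v mu : path_from v mu -> p v ** Spath v mu = Spath v mu.
Proof.
case: mu => [|e mu] /=; first by rewrite CK_pp.
by move=> /andP[/eqP <- _]; rewrite cmulA CK_p_s.
Qed.

Lemma Spath_r v mu : Spath v mu ** p (path_end v mu) = Spath v mu.
Proof.
elim: mu v => [|e mu IH] v /=; first exact: CK_pp.
by rewrite -cmulA IH.
Qed.

Lemma Spath_iso v mu : path_from v mu ->
  cstar (Spath v mu) ** Spath v mu = p (path_end v mu).
Proof.
elim: mu v => [|e mu IH] v /=; first by rewrite CK_pT CK_pp.
move=> /andP[_ pmu]; rewrite cstarM cmulA -[X in X ** _]cmulA (CK_src CK).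
by rewrite -cmulA Spath_l// IH.
Qed.

Lemma Spath_cat v mu nu : path_from v (mu ++ nu) ->
  Spath v (mu ++ nu) = Spath v mu ** Spath (path_end v mu) nu.
Proof.
elim: mu v => [|e mu IH] v /=; first by move=> ?; rewrite Spath_l.
by move=> /andP[_ pmn]; rewrite IH// cmulA.
Qed.

Lemma Spath_quot v mu nu : path_from v (mu ++ nu) ->
  cstar (Spath v mu) ** Spath v (mu ++ nu) = Spath (path_end v mu) nu.
Proof.
move=> pmn; have := pmn; rewrite path_from_cat => /andP[pm pn].
by rewrite Spath_cat// cmulA Spath_iso// Spath_l.
Qed.

Lemma Spath_orth v mu nu : path_from v mu -> path_from v nu ->
  ~~ prefix mu nu -> ~~ prefix nu mu -> cstar (Spath v mu) ** Spath v nu = 0.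
Proof.
elim: mu v nu => [|e mu IH] v [|f nu] //=.
move=> /andP[_ pm] /andP[_ pn].
rewrite cstarM cmulA -[X in X ** _]cmulA.
have [ef|ef] := eqVneq e f; last by rewrite CK_edge_orth// mulc0 mul0c.
rewrite -ef in pn *; rewrite /= => mn nm; rewrite (CK_src CK) -cmulA Spath_l//.
exact: IH.
Qed.


Lemma SS_l x : gvalid x -> p x.1 ** SS x = SS x.
Proof. exact: Spath_l. Qed.

Lemma SS_r x : SS x ** p (gend x) = SS x.
Proof. exact: Spath_r. Qed.

Lemma SS_iso x : gvalid x -> cstar (SS x) ** SS x = p (gend x).
Proof. exact: Spath_iso. Qed.

Lemma SS_cat x mu : gvalid (gcat x mu) ->
  SS (gcat x mu) = SS x ** Spath (gend x) mu.
Proof. exact: Spath_cat. Qed.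

(** The product depends on which path extends the other. Equal paths belong to the first case, with
    [mu] empty, hence the condition on [mu] in the second. *)
Variant SS_mul_spec x y : A -> Prop :=
| SSMulLeft mu of y = gcat x mu & path_from (gend x) mu :
    SS_mul_spec x y (Spath (gend x) mu)
| SSMulRight mu of x = gcat y mu & path_from (gend y) mu & mu != [::] :
    SS_mul_spec x y (cstar (Spath (gend y) mu))
| SSMulZero of x != y : SS_mul_spec x y 0.

Lemma SS_mulP x y : gvalid x -> gvalid y ->
  SS_mul_spec x y (cstar (SS x) ** SS y).
Proof.
move: x y => [v mu] [w nu]; rewrite /gvalid /SS /= => vm wn.
have [vw|vw] := eqVneq v w; last first.
  rewrite -(Spath_l vm) -(Spath_l wn) cstarM CK_pT cmulA -[X in X ** _]cmulA.
  rewrite (CK_orth CK); last exact/eqP.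
  rewrite mulc0 mul0c; apply: SSMulZero.
  by apply: contra_neq vw => -[].
rewrite -{w}vw in wn *.
have [/prefixP[k nuE]|mn] := boolP (prefix mu nu).
  rewrite nuE in wn *; rewrite Spath_quot//.
  apply: (@SSMulLeft (v, mu) (v, mu ++ k)) => //.
  by move: wn; rewrite path_from_cat => /andP[].
have [/prefixP[k muE]|nm] := boolP (prefix nu mu).
  rewrite muE in vm mn *; rewrite -[Spath v nu]cstarK -cstarM Spath_quot//.
  apply: (@SSMulRight (v, nu ++ k) (v, nu)) => //.
    by move: vm; rewrite path_from_cat => /andP[].
  by apply: contraNneq mn => ->; rewrite cats0 prefix_refl.
rewrite Spath_orth//; apply: SSMulZero.
by apply: contraNneq mn => -[->]; rewrite prefix_refl.
Qed.

Definition TT x y : A := SS x ** cstar (SS y).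

Definition matched x y : bool := [&& gvalid x, gvalid y & gend x == gend y].

Definition monomial (d : int) (a : A) : Prop :=
  exists x y, [/\ matched x y, glen x - glen y = d & a = TT x y].

Lemma monomial_SS x : gvalid x -> monomial (glen x) (SS x).
Proof.
move=> vx; exists x, (gend x, [::]); split.
- by rewrite /matched vx /gvalid/= /gend/=.
- by rewrite /glen subr0.
- by rewrite /TT /SS/= CK_pT; rewrite -[X in _ ** p X]/(gend x) SS_r.
Qed.

Lemma monomial_cstar d a : monomial d a -> monomial (- d) (cstar a).
Proof.
move=> [x [y [/and3P[vx vy /eqP xy] <- ->]]]; exists y, x; split.
- by rewrite /matched vx vy xy eqxx.
- by rewrite opprB.
- by rewrite /TT cstarM cstarK.
Qed.

(** The middle factor [cstar (SS y) ** SS x'] is a path element, the adjoint of one, or 0; in the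
    first two cases an outer factor absorbs it, and lengths add up accordingly. *)
Lemma TT_mul x y x' y' : matched x y -> matched x' y' ->
  TT x y ** TT x' y' = 0 \/
  monomial ((glen x - glen y) + (glen x' - glen y')) (TT x y ** TT x' y').
Proof.
move=> /and3P[vx vy /eqP xy] /and3P[vx' vy' /eqP xy'].
have -> : TT x y ** TT x' y' = SS x ** (cstar (SS y) ** SS x') ** cstar (SS y').
  by rewrite /TT !cmulA.
case: (SS_mulP vy vx') => [mu x'E pm|mu yE pm _|_]; last first.
- by left; rewrite mulc0 mul0c.
- right; have vc : gvalid (gcat y' mu) by rewrite gvalid_cat vy' -xy'.
  exists x, (gcat y' mu); split.
  + by rewrite /matched vx vc xy yE !gend_cat xy' eqxx.
  + by rewrite yE !glen_cat; lia.
  + by rewrite -cmulA -cstarM xy' -SS_cat.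
- right; have vc : gvalid (gcat x mu) by rewrite gvalid_cat vx xy.
  exists (gcat x mu), y'; split.
  + by rewrite /matched vc vy' -xy' x'E !gend_cat xy eqxx.
  + by rewrite x'E !glen_cat; lia.
  + by rewrite -xy -SS_cat.
Qed.

Definition homog (d : int) : A -> Prop := lspan (monomial d).

Lemma homogM d d' a b : homog d a -> homog d' b -> homog (d + d') (a ** b).
Proof.
move=> ha hb; apply: lspan_mulr ha => c [x [y [xy <- ->]]].
apply: lspan_mull hb => e [x' [y' [xy' <- ->]]].
by have [->|] := TT_mul xy xy'; [exact: lspan0|exact: lspan_incl].
Qed.

Lemma homog_cstar d a : homog d a -> homog (- d) (cstar a).
Proof.
by apply: lspan_cstar => b /monomial_cstar; exact: lspan_incl.
Qed.

Definition algebraic : A -> Prop := lspan (fun a => exists d, monomial d a).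

Lemma algebraicM a b : algebraic a -> algebraic b -> algebraic (a ** b).
Proof.
move=> ha hb; apply: lspan_mulr ha => c [d [x [y [xy _ ->]]]].
apply: lspan_mull hb => e [d' [x' [y' [xy' _ ->]]]].
have [->|h] := TT_mul xy xy'; first exact: lspan0.
by apply: lspan_incl; eexists; exact: h.
Qed.

Lemma algebraic_cstar a : algebraic a -> algebraic (cstar a).
Proof.
apply: lspan_cstar => b [d /monomial_cstar h].
by apply: lspan_incl; eexists; exact: h.
Qed.

Lemma algebraic_dense a (e : R) : generates (range p `|` range s) -> 0 < e ->
  exists2 b, algebraic b & nr (a - b) < e.
Proof.
move=> gen; suff : [set a | forall e : R, 0 < e ->
    exists2 b, algebraic b & nr (a - b) < e] = setT.
  by move=> S; have : [set: A] a by []; rewrite -S => /(_ e); exact.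
have SSalg x : gvalid x -> algebraic (SS x).
  by move=> /monomial_SS h; apply: lspan_incl; eexists; exact: h.
apply: gen => [||_ [[v _ <-]|[f _ <-]] d d0].
- split => /=.
  + move=> d d0; exists 0; first exact: lspan0.
    by rewrite subrr nr0.
  + move=> x y hx hy d d0; have [|b bA xb] := hx (d / 2); first lra.
    have [|c cA yc] := hy (d / 2); first lra.
    exists (b + c); first exact: lspanD.
    by rewrite opprD addrACA (le_lt_trans (nrD _ _))//; lra.
  + move=> k x hx d d0; set c := complex.Re `|k|.
    have c0 : 0 <= c by rewrite /c normc_def sqrtr_ge0.
    have [|b bA xb] := hx (d / (1 + c)); first by rewrite divr_gt0//; lra.
    exists (k *: b); first exact: lspanZ.
    have c1 : 0 < 1 + c by lra.
    move: xb; rewrite -scalerBr nrZ -/c ltr_pdivlMr//.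
    by have := nr_ge0 (x - b); nra.
  + move=> x y hx hy d d0; have x0 := nr_ge0 x; have y0 := nr_ge0 y.
    have d1 : 0 < d / (2 + nr x + nr y) by rewrite divr_gt0//; lra.
    (* As m <= 1, the norm of [b] is below nr x + 1, and the error of [b ** c] is at most m (1 + nr
       x + nr y). *)
    pose m := Num.min 1 (d / (2 + nr x + nr y)).
    have m0 : 0 < m by rewrite lt_min d1 ltr01.
    have m1 : m <= 1 by rewrite ge_min lexx.
    have md : m * (2 + nr x + nr y) <= d.
      by rewrite -ler_pdivlMr ?ge_min ?lexx ?orbT//; lra.
    have [b bA xb] := hx m m0; have [c cA yc] := hy m m0.
    exists (b ** c); first exact: algebraicM.
    have -> : x ** y - b ** c = (x - b) ** y + b ** (y - c).
      by rewrite mulBc mulcB addrA subrK.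
    have := nrD ((x - b) ** y) (b ** (y - c)).
    have := nrM (x - b) y; have := nrM b (y - c).
    have := nrBB x b 0; rewrite !subr0 nrC.
    have := nr_ge0 (x - b); have := nr_ge0 (y - c); have := nr_ge0 b.
    by nra.
  + move=> x hx d d0; have [b bA xb] := hx d d0.
    exists (cstar b); first exact: algebraic_cstar.
    by rewrite -cstarB nr_cstar.
- apply: approx_closed => x hx /= d d0; have [|y hy xy] := hx (d / 2);
  first lra.
  have [|b bA yb] := hy (d / 2); first lra.
  by exists b => //; apply: (le_lt_trans (nrBB y _ _)); lra.
- exists (p v); last by rewrite subrr nr0.
  exact: (SSalg (v, [::])).
- exists (s f); last by rewrite subrr nr0.
  by rewrite -CK_s_src; apply: (SSalg (rng f, [:: f])); rewrite /gvalid/= eqxx.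
Qed.

Definition graded (l : seq (int * A)) : Prop :=
  forall t, t \in l -> homog t.1 t.2.

Definition total (l : seq (int * A)) : A := \sum_(t <- l) t.2.

(** Computed from the list and not from its total, so that the independence of the homogeneous parts
    never comes up. *)
Definition component (n : int) (l : seq (int * A)) : A :=
  \sum_(t <- l | t.1 == n) t.2.

Lemma algebraic_graded a : algebraic a -> exists2 l, graded l & a = total l.
Proof.
elim=> [|k x y [d dx] _ [l lg ->]]; first by exists [::];
  rewrite // /total big_nil.
exists ((d, k *: x) :: l); last by rewrite /total big_cons.
move=> t; rewrite inE => /orP[/eqP -> /=|/lg//].
by apply: lspanZ; exact: lspan_incl.
Qed.

Lemma component_homog n l : graded l -> homog n (component n l).
Proof.
move=> lg; rewrite /component -big_filter; apply: lspan_sum => t.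
by rewrite mem_filter => /andP[/eqP <- /lg].
Qed.

Lemma gauge_homog (gamma : A -> A) (z : R[i]) d a : star_hom gamma ->
  `|z| = 1 -> (forall v, gamma (p v) = p v) ->
  (forall e, gamma (s e) = z *: s e) -> homog d a -> gamma a = (z ^ d) *: a.
Proof.
move=> gP z1 gp gs; have z0 : z != 0 by rewrite -normr_eq0 z1 oner_eq0.
have gS v mu : gamma (Spath v mu) = (z ^+ size mu) *: Spath v mu.
  elim: mu v => [|e mu IH] v /=; first by rewrite gp scale1r.
  by rewrite (star_homM gP) gs IH cmulZl cmulZr scalerA exprS.
have zV : Num.conj z =
  z^-1 by rewrite -[LHS]mul1r -[1](mulVf z0) -mulrA -normCK z1 expr1n mulr1.
elim=> [|k b c [x [y [_ <- ->]]] _ IH].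
  by rewrite star_hom0// scaler0.
rewrite star_homD// star_homZ// IH scalerDr; congr (_ + _).
rewrite /TT (star_homM gP) (star_hom_cstar gP) /SS !gS cstarZ cmulZl cmulZr.
have -> : z ^ (glen x - glen y) = z ^+ size x.2 * Num.conj (z ^+ size y.2).
  by rewrite expfzDr// rmorphXn/= zV exprVn exprnN exprnP.
by rewrite !scalerA; congr (_ *: _); ring.
Qed.

End PathElements.

(** * Condition (L) *)

Section ConditionL.
Variable E : digraph.
Implicit Types (v w u : vertex E) (e a : edge E) (mu nu : seq (edge E)).

Definition is_source v := forall e, rng e <> v.

Lemma path_fromE v e mu :
  path_from v (e :: mu) = (rng e == v) && path (@composable E) e mu.
Proof.
rewrite /=; congr (_ && _).
by elim: mu e => //= f mu IH e; rewrite IH /composable eq_sym.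
Qed.

Lemma path_endE v e mu : path_end v (e :: mu) = src (last e mu).
Proof. by elim: mu e => //= f mu IH e; rewrite IH. Qed.

Lemma source_path v mu : is_source v -> path_from v mu -> mu = [::].
Proof. by case: mu => // e mu vs /andP[/eqP /vs]. Qed.

Definition closed_at u mu := [&& mu != [::], path_from u mu & path_end u mu ==
  u].

Lemma closed_at_cycle u mu : closed_at u mu -> is_cycle mu.
Proof.
case: mu => // e mu /andP[_]; rewrite path_fromE path_endE /is_cycle.
by move=> /andP[/andP[/eqP -> ->] /eqP ->].
Qed.

(** Aperiodicity up to [L]: unless [t] stops at a source, its last edge differs from each of the [L]
    edges before it, so no shift by 1 to [L] places matches the end of [t] with an earlier part. *)
Definition escaping (L : nat) (t : gpath E) : Prop :=
  gvalid t /\ (is_source (gend t) \/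
  exists mu e, [/\ t.2 = rcons mu e, (L <= size mu)%N &
                   e \notin drop (size mu - L) mu]).

Lemma closed_at_iter u mu n : closed_at u mu ->
  path_from u (flatten (nseq n mu)) /\ path_end u (flatten (nseq n mu)) = u.
Proof.
move=> /and3P[_ pm /eqP em]; elim: n => //= n [IH1 IH2].
by rewrite path_from_cat path_end_cat pm em.
Qed.

(** Take a shortest cycle reachable from [w]. Its entry [e] cannot lie on it. Paths being read from
    range to source, t can wind [L] times around the cycle and then leave it through [e]. *)
Lemma escaping_cycle w L : condition_L E ->
  (exists mu nu, path_from w mu /\ closed_at (path_end w mu) nu) ->
  exists t : gpath E, t.1 = w /\ escaping L t.
Proof.
move=> EL ex; pose P n := `[< exists mu nu,
  [/\ path_from w mu, closed_at (path_end w mu) nu & size nu = n] >].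
have exP : exists n, P n.
  by have [mu [nu [? ?]]] := ex; exists (size nu); apply/asboolP; exists mu, nu.
have [k [kap [al [pk cl <-]]] kmin] :
    exists2 k, exists mu nu,
      [/\ path_from w mu, closed_at (path_end w mu) nu & size nu = k] &
    forall mu nu, path_from w mu -> closed_at (path_end w mu) nu ->
      (k <= size nu)%N.
  have [k /asboolP Pk kmin] := ex_minnP exP; exists k => // mu nu pm cn.
  by apply: kmin; apply/asboolP; exists mu, nu.
have [a [e [/splitPr ain ea rea]]] := EL al (closed_at_cycle cl).
case: ain cl kmin => al1 al2 cl kmin; have /and3P[_] := cl.
rewrite path_from_cat path_end_cat => /andP[p1 /= /andP[/eqP ra p2]] /eqP e2.
pose be := a :: al2 ++ al1; set u := path_end w kap in cl p1 e2 ra p2.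
have ua : path_end u al1 = rng a by [].
have cb : closed_at (rng a) be.
  by rewrite /closed_at /= eqxx path_from_cat path_end_cat p2 e2 p1 ua eqxx.
have pka : path_from w (kap ++ al1) by rewrite path_from_cat pk.
have eka : path_end w (kap ++ al1) = rng a by rewrite path_end_cat.
(* If [e] occurred on the cycle, the path would be back at the range of [a] just before it, which
   closes a shorter cycle. *)
have ebe : e \notin be.
  apply/negP; rewrite inE => /orP[/eqP //|ein].
  have [b1 [b2 bE]] : exists b1 b2, al2 ++ al1 = b1 ++ e :: b2.
    by case/splitPr: ein => b1 b2; exists b1, b2.
  have /and3P[_] := cb; rewrite /be bE /= eqxx /= path_from_cat /=.
  move=> /and3P[pb1 /eqP eb1 _] _.
  have := kmin (kap ++ al1) (a :: b1) pka.
  rewrite eka /closed_at /= eqxx pb1 -eb1 rea eqxx => /(_ isT).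
  by move: (congr1 size bE); rewrite !size_cat /=; lia.
have [pit eit] := closed_at_iter L cb.
exists (w, rcons ((kap ++ al1) ++ flatten (nseq L be)) e); split=> //; split.
  set m := (_ ++ flatten _); have pm : path_from w m.
    by rewrite path_from_cat pka eka pit.
  have em : path_end w m = rng a by rewrite /m path_end_cat eka.
  by rewrite /gvalid /= -cats1 path_from_cat pm em /= rea eqxx.
right; exists ((kap ++ al1) ++ flatten (nseq L be)), e; split=> //.
  rewrite size_cat size_flatten /shape map_nseq sumn_nseq /=.
  by rewrite mulSn addnCA leq_addr.
set m1 := kap ++ al1; set m2 := flatten _.
have Lm2 : (L <= size m2)%N.
  by rewrite size_flatten /shape map_nseq sumn_nseq /= mulSn leq_addr.
rewrite drop_cat size_cat; case: ltnP => [|_]; first lia.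
apply/negP => /mem_drop /flattenP[r]; rewrite mem_nseq => /andP[_ /eqP ->].
exact/negP.
Qed.

(** Either a cycle can be reached from [w], or a source can, or else there are arbitrarily long
    paths, which repeat no edge because a repetition closes a cycle. *)
Lemma escaping_exists w L : condition_L E ->
  exists t : gpath E, t.1 = w /\ escaping L t.
Proof.
move=> EL.
have [|nocycle] := pselect (exists mu nu,
  path_from w mu /\ closed_at (path_end w mu) nu); first exact: escaping_cycle.
have [[mu [pm sm]]|nosource] :=
  pselect (exists mu, path_from w mu /\ is_source (path_end w mu)).
  by exists (w, mu); split=> //; split=> //; left.
have long n : exists2 mu, path_from w mu & size mu = n.
  elim: n => [|n [mu pm <-]]; first by exists [::].
  have [e re] : exists e, rng e = path_end w mu.
    apply: contrapT => noe; apply: nosource; exists mu; split=> // e re.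
    by apply: noe; exists e.
  exists (rcons mu e); last by rewrite size_rcons.
  by rewrite -cats1 path_from_cat pm /= re eqxx.
have [mu pm mL] := long L.+1.
case/lastP: mu pm mL => // mu e pm; rewrite size_rcons => -[mL].
exists (w, rcons mu e); split=> //; split=> //; right; exists mu, e.
split=> //; first by rewrite mL.
apply/negP => /mem_drop /splitPr emu; case: emu pm {mL} => m1 m2 pm.
apply: nocycle; exists m1, (e :: m2); move: pm.
rewrite -cats1 path_from_cat path_end_cat path_from_cat /=.
move=> /andP[/and3P[pm1 /eqP em1 pm2] /andP[/eqP ee _]].
by rewrite pm1 /closed_at /= em1 eqxx pm2 -ee em1 eqxx.
Qed.

End ConditionL.

(** * Compression by escaping paths *)

Section Compression.
Variables (R : realType) (E : digraph) (A : cstarAlgType R).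
Variables (p : vertex E -> A) (s : edge E -> A).
Hypotheses (Efin : row_finite E) (CK : CK_family p s).
Implicit Types (x y t : gpath E).
Local Notation SS := (SS p s).
Local Notation TT := (TT p s).

(** If the product is not 0, then t = x t1 = y t2 and t1 = t2 mu with |mu| = |y| - |x| > 0. A source
    at the end of t excludes mu. Otherwise the last edge of t is that of t2, and t = x t2 mu shows
    it again |mu| <= L places earlier. *)
Lemma escaping_kill_lt (L : nat) t x y : escaping L t -> matched x y ->
  (size x.2 < size y.2)%N -> (size y.2 <= L)%N ->
  cstar (SS t) ** TT x y ** SS t = 0.
Proof.
move=> [vt esc] /and3P[vx vy /eqP xy] lt yL.
have tL : is_source (gend t) \/ (L < size t.2)%N.
  by case: esc => [|[mu [e [-> ? _]]]]; [left|right; rewrite size_rcons].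
have assoc : cstar (SS t) ** TT x y ** SS t =
    cstar (cstar (SS x) ** SS t) ** (cstar (SS y) ** SS t).
  by rewrite cstarM cstarK /TT !cmulA.
rewrite {}assoc.
(* A path of length at most [L] does not properly extend [t], which ends at a source or is longer
   than [L]. *)
have short z mu : z = gcat t mu -> path_from (gend t) mu -> (size z.2 <= L)%N ->
    mu = [::].
  move=> zE pm zL; case: tL => [ts|tL]; first exact: source_path pm.
  by move: zL; rewrite zE /= size_cat; case: mu {pm zE} => //= ? ?; lia.
case: (SS_mulP Efin CK vx vt) => [t1 t1E p1|mu xE pm mu0|_]; last first.
- by rewrite cstar0 mul0c.
- by rewrite (short x mu) ?eqxx// in mu0; lia.
case: (SS_mulP Efin CK vy vt) => [t2 t2E p2|mu yE pm mu0|_]; last first.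
- by rewrite mulc0.
- by rewrite (short y mu) ?eqxx// in mu0.
rewrite -xy in p2 *.
have tE : x.2 ++ t1 = y.2 ++ t2 by move: t2E; rewrite t1E => -[].
case: (@SS_mulP _ _ _ _ _ Efin CK (gend x, t1) (gend x, t2) p1 p2)
  => [mu [t2t1] _|mu [t1t2] pm mu0|//].
  by move: (congr1 size tE); rewrite t2t1 !size_cat; lia.
have gt : gend t = path_end (gend x) t2.
  by rewrite t2E gend_cat xy.
case: esc => [ts|[ka [e [tke Lka eka]]]].
  by case/eqP: mu0; apply: (source_path ts); rewrite gt; exact: pm.
move: (congr1 size tE); rewrite t1t2 !size_cat => sizes.
have st : (size t.2 = size y.2 + size t2)%N by rewrite t2E /= size_cat.
have kaE1 : rcons ka e = y.2 ++ t2 by rewrite -tke t2E.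
have kaE2 : rcons ka e = x.2 ++ t2 ++ mu by rewrite -t1t2 -tke t1E.
have t2n : t2 != [::].
  apply: contraTneq (yL) => t20; rewrite -ltnNge.
  by move: st; rewrite tke size_rcons t20 /=; lia.
case/lastP: t2 t2n kaE1 kaE2 sizes {t2E p2 tE t1t2 gt st pm} => // t3 f _.
rewrite -rcons_cat => /rcons_inj[_ <-].
case/lastP: mu mu0 => // mu g _.
rewrite -!rcons_cat => /rcons_inj[kaE _] sizes.
case/negP: eka; rewrite kaE cat_rcons catA drop_cat.
move: sizes; rewrite !size_rcons !size_cat /= => sizes.
case: ltnP => [_|]; first by rewrite mem_cat inE eqxx orbT.
move=> ?; rewrite (_ : (_ - _ - _)%N = 0%N); last by rewrite ?size_cat; lia.
by rewrite drop0 inE eqxx.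
Qed.

Lemma escaping_kill (L : nat) t x y : escaping L t -> matched x y ->
  size x.2 != size y.2 -> (size x.2 <= L)%N -> (size y.2 <= L)%N ->
  cstar (SS t) ** TT x y ** SS t = 0.
Proof.
move=> te xy; rewrite neq_ltn => /orP[lt _ yL|lt xL _].
  exact: escaping_kill_lt yL.
have yx : matched y x.
  by move: xy => /and3P[vx vy /eqP xy]; rewrite /matched vx vy xy eqxx.
have adj : cstar (cstar (SS t) ** TT x y ** SS t) =
    cstar (SS t) ** TT y x ** SS t.
  by rewrite /TT !cstarM !cstarK cmulA.
by rewrite -[LHS]cstarK adj (escaping_kill_lt te yx lt xL) cstar0.
Qed.

End Compression.

(** * Homogeneous elements attain their norm *)

Section Levels.
Variables (R : realType) (E : digraph) (A : cstarAlgType R).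
Variables (p : vertex E -> A) (s : edge E -> A).
Hypotheses (Efin : row_finite E) (CK : CK_family p s).
Implicit Types (x y t : gpath E) (a b m : A) (k n d : int).
Local Notation SS := (SS p s).
Local Notation TT := (TT p s).

(* The length [j] can be smaller than [k] for paths stopped by a source; it is
   recorded so that the vectors of a level are homogeneous. *)
Definition level k w j x : Prop :=
  [/\ gvalid x, gend x = w, glen x = j & j = k \/ (j <= k /\ is_source w)].

Definition level_vec k w j : A -> Prop :=
  lspan (fun a => exists x, level k w j x /\ a = SS x).

(** Combinations of matrix units that carry vectors of level [k] to vectors of level [k + n]. *)
Definition level_op k n : A -> Prop :=
  lspan (fun a => exists w j x y,
    [/\ level (k + n) w (j + n) x, level k w j y & a = TT x y]).

Lemma level_le k w j x : level k w j x -> glen x <= k.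
Proof. by case=> _ _ -> [->|[]]. Qed.

Lemma level_ext k w j x mu : level k w j x -> path_from w mu ->
  glen x + (size mu)%:Z <= k -> mu = [::].
Proof.
move=> [_ _ -> [->|[_ ws]]] pm; last by move=> _; exact: source_path pm.
by case: mu pm => // ? ? _ /=; lia.
Qed.

(** Of two distinct paths of one level, neither extends the other: each has full length [k] or is
    stopped by a source. *)
Lemma level_orth k w u i j x y : level k w i x -> level k u j y ->
  cstar (SS x) ** SS y = if x == y then p w else 0.
Proof.
move=> lx ly; have [vx xw _ _] := lx; have [vy yu _ _] := ly.
have [<-|xy] := eqVneq x y; first by rewrite SS_iso// xw.
case: (SS_mulP Efin CK vx vy) => [mu yE pm|mu xE pm mu0|//].
  have mu0 : mu = [::].
    apply: (level_ext lx); first by rewrite -xw.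
    by rewrite -glen_cat -yE; exact: level_le ly.
  by case/eqP: xy; rewrite yE mu0 /gcat cats0; case: (x).
case/eqP: mu0; apply: (level_ext ly); first by rewrite -yu.
by rewrite -glen_cat -xE; exact: level_le lx.
Qed.

Lemma lspan_multiple (q a : A) : lspan (eq^~ q) a -> exists c, a = c *: q.
Proof.
elim=> [|c x y -> _ [c' ->]]; first by exists 0; rewrite scale0r.
by exists (c + c'); rewrite scalerDl.
Qed.

Lemma level_vec_inner k w j a b : level_vec k w j a -> level_vec k w j b ->
  exists c, cstar a ** b = c *: p w.
Proof.
move=> ha hb; apply: lspan_multiple.
have {}ha : lspan (fun a =>
  exists x, level k w j x /\ a = cstar (SS x)) (cstar a).
  by apply: lspan_cstar ha => _ [x [lx ->]]; apply: lspan_incl; exists x.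
apply: lspan_mulr ha => _ [x [lx ->]].
apply: lspan_mull hb => _ [y [ly ->]].
rewrite (level_orth lx ly); case: ifP => _; last exact: lspan0.
exact: lspan_incl.
Qed.

(** The Cuntz-Krieger relation at the common source splits [TT x y] into a sum over the edges f into
    it, with f appended to both paths. This is repeated until the second path has length [k] or
    meets a source. *)
Lemma TT_level k d x y : matched x y -> glen x - glen y = d -> glen y <= k ->
  level_op k d (TT x y).
Proof.
move=> xy xyd yk; have [N NE] : exists N : nat, k - glen y = N%:Z.
  by exists `|k - glen y|%N; lia.
elim: N x y xy xyd {yk} NE =>
  [|N IH] x y /[dup] xy /and3P[vx vy /eqP xye] xyd NE.
  apply: lspan_incl; exists (gend y), (glen y), x, y; split=> //; split=> //;
    try left; lia.
have [ws|nws] := pselect (is_source (gend y)).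
  apply: lspan_incl; exists (gend y), (glen y), x, y.
  by split=> //; split=> //; (lia || right; split=> //; lia).
have [e re] : exists e, rng e = gend y.
  by apply: contrapT => noe; apply: nws => e re; apply: noe; exists e.
have -> : TT x y = \sum_(f <- fset_set (@rng E @^-1` [set rng e]))
    TT (gcat x [:: f]) (gcat y [:: f]).
  rewrite /TT -(SS_r CK x) xye -re (CK_rng_seq Efin CK) mulc_sumr mulc_suml.
  apply: eq_big_seq => f; rewrite (mem_rng_seq Efin) re => /eqP rf.
  have Ef z : gvalid z -> gend z = gend y -> SS (gcat z [:: f]) = SS z ** s f.
    move=> vz zy; rewrite (SS_cat Efin CK).
      by rewrite zy /= (CK_s_src CK).
    by rewrite gvalid_cat vz zy /= rf eqxx.
  by rewrite !Ef// cstarM !cmulA.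
apply: lspan_sum => f; rewrite (mem_rng_seq Efin) re => /eqP rf.
apply: IH; rewrite ?glen_cat /=; last by lia.
  by rewrite /matched !gvalid_cat !gend_cat vx vy xye /= rf !eqxx.
by lia.
Qed.

Lemma homog_level d a : homog p s d a ->
  exists k0, forall k, k0 <= k -> level_op k d a.
Proof.
elim=> [|c b e [x [y [xy xyd ->]]] _ [k0 IH]].
  by exists 0 => k _; exact: lspan0.
exists (Num.max (glen y) k0) => k; rewrite ge_max => /andP[yk k0k].
apply: lspanD; last exact: IH.
by apply: lspanZ; exact: TT_level.
Qed.

Lemma level_op_vec k n w j m a : level_op k n m -> level_vec k w j a ->
  level_vec (k + n) w (j + n) (m ** a).
Proof.
move=> hm ha; apply: lspan_mulr hm => _ [u [i [x [y [lx ly ->]]]]].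
apply: lspan_mull ha => _ [z [lz ->]].
rewrite /TT -cmulA (level_orth ly lz); case: eqP => [yz|_]; last first.
  by rewrite mulc0; exact: lspan0.
have [_ xu _ _] := lx; have [_ yu yi _] := ly; have [_ zw zj _] := lz.
rewrite -xu (SS_r CK); apply: lspan_incl; exists x; split=> //.
by rewrite -zw -zj -yz yu yi.
Qed.

Lemma level_op_cstar k n m : level_op k n m -> level_op (k + n) (- n) (cstar m).
Proof.
apply: lspan_cstar => _ [w [j [x [y [lx ly ->]]]]]; apply: lspan_incl.
by exists w, (j + n), y, x; split; rewrite ?addrK// /TT cstarM cstarK.
Qed.

Lemma nr_SS x : gvalid x -> nr (SS x) <= 1.
Proof.
move=> vx; rewrite -(@ler_sqr _ (nr _)) ?nnegrE ?nr_ge0// expr1n -nr_cstarM.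
by rewrite (SS_iso Efin CK)//; apply: nr_proj; exact: (CK_proj CK).
Qed.

(** The constant is the sum of the moduli of the coefficients of [m]. It serves all [a] at once;
    [norm_attained] takes longer and longer products for [a]. *)
Lemma level_op_bound k n m : level_op k n m -> exists2 C : R, 0 <= C &
  forall a B, 0 <= B -> (forall w j x, level (k + n) w j x ->
    nr (a ** SS x) <= B) ->
    nr (a ** m) <= C * B.
Proof.
elim=> [|c b e [w [j [x [y [lx ly ->]]]]] _ [C C0 IH]].
  by exists 0 => // a B _ _; rewrite mulc0 nr0 mul0r.
have c0 : 0 <= complex.Re `|c| by rewrite normc_def sqrtr_ge0.
exists (complex.Re `|c| + C) => [|a B B0 aB]; first by rewrite addr_ge0.
rewrite cmulDr cmulZr mulrDl (le_trans (nrD _ _))// lerD ?IH//.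
rewrite nrZ ler_wpM2l// /TT cmulA (le_trans (nrM _ _))//.
have [vy _ _ _] := ly; have := nr_SS vy; rewrite nr_cstar.
have := aB _ _ _ lx; have := nr_ge0 (a ** SS x); have := nr_ge0 (SS y).
by nra.
Qed.

(** The power of exponent j + 1: there is no unit to serve as the power 0. *)
Fixpoint pow1 a (j : nat) : A := if j is j'.+1 then a ** pow1 a j' else a.

Lemma pow1D a i j : pow1 a i ** pow1 a j = pow1 a (i + j).+1.
Proof. by elim: i => [|i IH] //=; rewrite -cmulA IH. Qed.

Lemma nr_pow1 h i : cstar h = h -> nr (pow1 h (2 ^ i).-1) = nr h ^+ (2 ^ i).
Proof.
move=> hT; have powT j : cstar (pow1 h j) = pow1 h j.
  elim: j => [|j IH] //=; rewrite cstarM IH hT.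
  by elim: j {IH} => [|j IH] //=; rewrite -cmulA IH.
elim: i => [|i IH]; first by rewrite expn0 expr1.
have -> : (2 ^ i.+1).-1 = ((2 ^ i).-1 + (2 ^ i).-1).+1.
  by have := expn_gt0 2 i; rewrite expnS; lia.
rewrite -pow1D -{1}powT nr_cstarM IH -exprM; congr (_ ^+ _).
by rewrite expnS mulnC.
Qed.

(* [nr m ^ (2 N) = nr ((m^* m) ^ N)] is at most a constant times
   [T ^ (2 N - 1)] when [m] expands no vector by more than [T]. *)
Lemma norm_attained k n m (T : R) : level_op k n m -> 0 <= T -> T < nr m ->
  exists w j a, level_vec k w j a /\ T * nr a < nr (m ** a).
Proof.
move=> hm T0 Tm; apply: contrapT => none.
have up w j a : level_vec k w j a -> nr (m ** a) <= T * nr a.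
  by move=> ha; rewrite leNgt; apply/negP => h; apply: none; exists w, j, a.
(* The adjoint inherits the bound: for b = m^* a one has |b|^2 = |a^* m b| <= |a| T |b|. *)
have down w j a : level_vec (k + n) w j a ->
    level_vec k w (j - n) (cstar m ** a) /\ nr (cstar m ** a) <= T * nr a.
  move=> ha; have hb := level_op_vec (level_op_cstar hm) ha.
  rewrite addrK in hb; split=> //; set b := cstar m ** a in hb *.
  have bb : nr b * nr b <= nr a * (T * nr b).
    have bE : cstar b ** b = cstar a ** (m ** b).
      by rewrite {1}/b cstarM cstarK cmulA.
    rewrite -expr2 -nr_cstarM bE.
    apply: (le_trans (nrM _ _)); rewrite nr_cstar ler_wpM2l ?nr_ge0//.
    exact: up hb.
  have [->|b0] := eqVneq (nr b) 0; first by rewrite mulr_ge0// nr_ge0.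
  have {}b0 : 0 < nr b by rewrite lt0r b0 nr_ge0.
  by rewrite -(ler_pM2r b0) (le_trans bb)// mulrA (mulrC T).
pose h := cstar m ** m; have hT : cstar h = h by rewrite /h cstarM cstarK.
pose aa := fix aa j := if j is j'.+1 then h ** aa j' else cstar m.
have aam j : aa j ** m = pow1 h j.
  by elim: j => [|j IH] //=; rewrite -cmulA IH.
have aaSS i w j x : level (k + n) w j x ->
    level_vec k w (j - n) (aa i ** SS x) /\ nr (aa i ** SS x) <= T ^+ (i.*2.+1).
  move=> lx; elim: i => [|i [IH1 IH2]] /=.
    have [|h1 h2] := down w j (SS x); first by apply: lspan_incl; exists x.
    split=> //; rewrite expr1 (le_trans h2)// ler_piMr//.
    by have [vx _ _ _] := lx; exact: nr_SS.
  rewrite /h -!cmulA; have hm1 := level_op_vec hm IH1.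
  rewrite subrK in hm1; have [h1 h2] := down _ _ _ hm1; split=> //.
  rewrite doubleS !exprS (le_trans h2)// ler_wpM2l//.
  by rewrite (le_trans (up _ _ _ IH1))// ler_wpM2l// -exprS.
have [C C0 mC] := level_op_bound hm.
have X0 : 0 < nr m by apply: le_lt_trans Tm.
set X := nr m in Tm X0 *.
(* With h = m^* m and X = |m|, the power 2^i of h has norm X^(q + 1), which is at most C T^q. Since
   T < X, large i will contradict X > 0. *)
have key i : X <= C * (T / X) ^+ (2 ^ i).-1.*2.+1.
  set q := (2 ^ i).-1.*2.+1.
  have : nr (pow1 h (2 ^ i).-1) <= C * T ^+ q.
    rewrite -aam; apply: mC => [|w j x lx]; first by rewrite exprn_ge0.
    by have [] := aaSS (2 ^ i).-1 w j x lx.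
  rewrite nr_pow1// nr_cstarM -exprM.
  have -> : (2 * 2 ^ i)%N = q.+1.
    by rewrite /q; have := expn_gt0 2 i; lia.
  by rewrite exprS expr_div_n mulrA ler_pdivlMr// exprn_gt0.
have r01 : 0 <= T / X < 1.
  by rewrite (divr_ge0 T0 (ltW X0)) ltr_pdivrMr// mul1r.
have e0 : 0 < X / (C + 1) by rewrite divr_gt0//; lra.
have [N rN] := exp_small r01 e0.
have qN : (N <= (2 ^ N).-1.*2.+1)%N by have := ltn_expl N (ltnSn 1); lia.
have := key N; have := rN _ qN; rewrite ltr_pdivlMr; last lra.
set z := (T / X) ^+ _; have z0 : 0 <= z by rewrite exprn_ge0//; case/andP: r01.
move=> h1 h2; suff : X < X by rewrite ltxx.
by nra.
Qed.

End Levels.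

(** * Fejer means *)

Section RootsOfUnity.
Variable R : realType.
Local Notation C := R[i].

Lemma complex_prim_root (M : nat) : (0 < M)%N ->
  exists w : C, M.-primitive_root w.
Proof.
move=> M0; have [r Dp] := @closed_field_poly_normal C ('X^M - 1).
rewrite (monicP _) ?monicXnsubC// scale1r in Dp.
have rn1 : all M.-unity_root r.
  by apply/allP => z; rewrite -root_prod_XsubC -Dp.
have sz_r : (M < (size r).+1)%N.
  by rewrite -(size_prod_XsubC r id) -Dp size_XnsubC.
have [|z] := hasP (has_prim_root M0 rn1 _ sz_r); last by exists z.
by rewrite -separable_prod_XsubC -Dp separable_Xn_sub_1// pnatr_eq0 -lt0n.
Qed.

Lemma prim_root_norm (M : nat) (w : C) : (0 < M)%N -> M.-primitive_root w ->
  `|w| = 1.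
Proof.
move=> M0 /prim_expr_order wM; apply/eqP; rewrite -(@pexpr_eq1 _ _ M)//.
by rewrite -normrX wM normr1.
Qed.

Lemma prim_root_sum (M : nat) (w : C) (e : int) : (0 < M)%N ->
  M.-primitive_root w -> (`|e|%N < M)%N ->
  \sum_(k < M) (w ^ e) ^+ k = if e == 0 then M%:R else 0.
Proof.
move=> M0 wP eM;
  have w0 : w != 0 by rewrite -normr_eq0 (prim_root_norm M0 wP) oner_eq0.
have [->|e0] := eqVneq e 0.
  rewrite (eq_bigr (fun=> 1)) => [|k _]; last by rewrite expr1n.
  by rewrite sumr_const card_ord.
have we1 : w ^ e != 1.
  have {}e0 : (0 < `|e|)%N by rewrite absz_gt0.
  have wn : w ^+ `|e| != 1.
    by rewrite -(prim_order_dvd wP) gtnNdvd.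
  case: (e) wn => n; rewrite ?absz_nat//= => wn.
  by rewrite NegzE -exprnN invr_eq1.
have : (w ^ e - 1) * \sum_(k < M) (w ^ e) ^+ k = 0.
  rewrite -subrX1 exprnP exprz_exp mulrC -exprz_exp -exprnP.
  by rewrite (prim_expr_order wP) exp1rz subrr.
by move/eqP; rewrite mulf_eq0 subr_eq0 (negPf we1) => /eqP.
Qed.

End RootsOfUnity.

Section Fejer.
Variables (R : realType) (E : digraph) (A : cstarAlgType R).
Variables (p : vertex E -> A) (s : edge E -> A) (gamma : R[i] -> A -> A).
Hypothesis gammaP : is_gauge_action p s gamma.
Implicit Types (l : seq (int * A)) (d n : int) (N : nat).

(* [N] times the [d]-th Fourier coefficient of the Fejer kernel of order [N]. *)
Definition fejer_count N d : nat :=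
  (\sum_(i < N) \sum_(j < N) (i%:Z + d == j%:Z)%R)%N.

Lemma fejer_inner N d (i : int) :
  (\sum_(j < N) (i + d == j%:Z)%R)%N = ((0 <= i + d) && (i + d < N%:Z) : nat).
Proof.
have [/andP[h1 h2]|h] := boolP ((0 <= i + d) && (i + d < N%:Z)).
  have jN : (`|(i + d)%R| < N)%N by lia.
  rewrite (bigD1 (Ordinal jN))//= big1 => [|j /eqP jn].
    by rewrite gez0_abs// eqxx.
  by case: eqP => // ij; case: jn; apply: val_inj => /=; lia.
rewrite big1// => j _; case: eqP => // ij; case/negP: h.
by have := ltn_ord j; lia.
Qed.

Lemma fejer_count_le N d : (fejer_count N d <= N)%N.
Proof.
rewrite -[leqRHS]card_ord -sum1_card; apply: leq_sum => i _.
by rewrite fejer_inner leq_b1.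
Qed.

Lemma fejer_count0 N : fejer_count N 0 = N.
Proof.
rewrite -[RHS]card_ord -sum1_card; apply: eq_bigr => i _.
by rewrite fejer_inner addr0; have := ltn_ord i; lia.
Qed.

Lemma fejer_count_out N d : (N <= `|d|)%N -> fejer_count N d = 0%N.
Proof.
move=> Nd; rewrite /fejer_count big1// => i _; rewrite fejer_inner.
by have := ltn_ord i; lia.
Qed.

(** The exact value is N - |d| when |d| <= N. Keeping only the i from |d| to N - |d| - 1 treats both
    signs of [d] together and costs a factor 2 on |d|. *)
Lemma fejer_count_ge N d : (N <= fejer_count N d + `|d|.*2)%N.
Proof.
have [Nd|dN] := leqP N `|d|.*2; first exact: leq_trans (leq_addl _ _).
rewrite addnC -leq_subLR; set m := `|d|%N in dN *.
have -> : fejer_count N d =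
    (\sum_(0 <= i < N) ((0 <= i%:Z + d) && (i%:Z + d < N%:Z))%R)%N.
  by rewrite big_mkord; apply: eq_bigr => i _; exact: fejer_inner.
rewrite (big_cat_nat (n := m))/=; [|lia|lia].
rewrite (big_cat_nat (m := m) (n := N - m))/=; [|lia|lia].
rewrite addnCA; apply: leq_trans (leq_addr _ _).
rewrite (eq_big_nat _ _ (F2 := fun=> 1%N)).
  by rewrite sum_nat_const_nat; lia.
by move=> i /andP[? ?]; lia.
Qed.

Definition fejer_weight N d : R := (fejer_count N d)%:R / N%:R.

Definition fejer_mean N l : A :=
  \sum_(t <- l) (fejer_weight N t.1)%:C%C *: t.2.

Lemma fejer_weight_bounds N d : 0 <= fejer_weight N d <= 1.
Proof.
rewrite /fejer_weight divr_ge0//=; have [->|N0] := posnP N.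
  by rewrite invr0 mulr0.
by rewrite ler_pdivrMr ?ltr0n// mul1r ler_nat fejer_count_le.
Qed.

Lemma fejer_weight_near1 N d : (0 < N)%N ->
  1 - fejer_weight N d <= (`|d|.*2)%:R / N%:R.
Proof.
move=> N0; have NR : 0 < N%:R :> R by rewrite ltr0n.
rewrite lerBlDl -mulrDl -natrD ler_pdivlMr// mul1r ler_nat.
exact: fejer_count_ge.
Qed.

(** The mean is a convex combination of translates of [total l] under [gamma], none of larger norm.
    As [l] has finitely many degrees, a sum over roots of unity replaces the integral over the
    circle. *)
Lemma fejer_mean_contract N l : (0 < N)%N -> graded p s l ->
  nr (fejer_mean N l) <= nr (total l).
Proof.
move=> N0 lg; pose D := (\max_(t <- l) `|t.1|%N)%N.
have lD t : t \in l -> (`|t.1| <= D)%N.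
  by move=> tl; rewrite /D (big_rem t)//= leq_maxl.
(* The frequencies i + d - j are below [M] in absolute value, so summing over the [M]-th roots of
   unity singles out frequency 0 exactly. *)
pose M := (N + D).+1; have M0 : (0 < M)%N by [].
have [w wP] := complex_prim_root R M0; have w1 := prim_root_norm M0 wP.
have w0 : w != 0 by rewrite -normr_eq0 w1 oner_eq0.
have wV (k : nat) : Num.conj (w ^+ k) = w ^ (- k%:Z).
  rewrite rmorphXn/= -exprnN -exprVn; congr (_ ^+ _).
  by rewrite -[LHS]mul1r -[1](mulVf w0) -mulrA -normCK w1 expr1n mulr1.
pose F (k : nat) : R[i] := \sum_(i < N) (w ^+ k) ^+ i.
(* The Fejer kernel at w^k divided by [M]; as a squared modulus it is nonnegative. *)
pose c (k : nat) : R := (complex.Re `|F k|) ^+ 2 / (M * N)%:R.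
have c0 k : 0 <= c k by rewrite divr_ge0// sqr_ge0.
have cE k : (c k)%:C%C = F k * Num.conj (F k) / (M * N)%:R.
  have normE : `|F k| = (complex.Re `|F k|)%:C%C.
    by rewrite RRe_real// realE normr_ge0.
  rewrite /c -normCK [in RHS]normE.
  by rewrite rmorphM/= fmorphV/= rmorph_nat rmorphXn.
have coef d : (`|d| <= D)%N ->
    \sum_(k < M) (c k)%:C%C * (w ^+ k) ^ d = (fejer_weight N d)%:C%C.
  move=> dD; rewrite /fejer_weight rmorphM/= fmorphV/= !rmorph_nat.
  under eq_bigr do rewrite cE mulrAC.
  rewrite -mulr_suml natrM invfM mulrA; congr (_ / _).
  have MC : M%:R != 0 :> R[i] by rewrite pnatr_eq0.
  apply: (mulIf MC); rewrite divfK//.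
  have term (k : nat) : F k * Num.conj (F k) * (w ^+ k) ^ d =
      \sum_(i < N) \sum_(j < N) (w ^ (i%:Z + d - j%:Z)) ^+ k.
    have u0 : w ^+ k != 0 by rewrite expf_neq0.
    have uT : Num.conj (w ^+ k) = (w ^+ k)^-1 by rewrite wV -exprnN.
    rewrite /F rmorph_sum/= big_distrlr/= mulr_suml; apply: eq_bigr => i _.
    rewrite mulr_suml; apply: eq_bigr => j _.
    rewrite rmorphXn/=
      uT mulrAC [RHS]exprnP exprz_exp (mulrC _ k%:Z) -exprz_exp.
    by rewrite -exprnP !expfzDr// exprVn exprnN exprnP.
  under eq_bigr do rewrite term.
  rewrite exchange_big/= /fejer_count natr_sum mulr_suml; apply: eq_bigr => i _.
  rewrite exchange_big/= natr_sum mulr_suml; apply: eq_bigr => j _.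
  have iN := ltn_ord i; have jN := ltn_ord j.
  rewrite (prim_root_sum M0 wP); last by rewrite /M; lia.
  by rewrite subr_eq0; case: ifP => _; rewrite ?mul1r ?mul0r.
have csum : \sum_(k < M) c k = 1.
  apply: complexI; rewrite rmorph_sum/= -[RHS](_ : (fejer_weight N 0)%:C%C = _).
    rewrite -coef//; apply: eq_bigr => k _; rewrite mulr1//.
  by rewrite /fejer_weight fejer_count0 divff// pnatr_eq0 -lt0n.
have gP (k : nat) : `|w ^+ k| = 1 by rewrite normrX w1 expr1n.
have -> : fejer_mean N l = \sum_(k < M) (c k)%:C%C *: gamma (w ^+ k) (total l).
  have -> : \sum_(k < M) (c k)%:C%C *: gamma (w ^+ k) (total l) =
      \sum_(k < M) \sum_(t <- l) ((c k)%:C%C * (w ^+ k) ^ t.1) *: t.2.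
    apply: eq_bigr => k _; have [ghom gp gs] := gammaP (gP k).
    rewrite /total star_hom_sum// scaler_sumr; apply: eq_big_seq => t tl.
    by rewrite (gauge_homog ghom (gP k) gp gs (lg t tl)) scalerA.
  rewrite exchange_big/=; apply: eq_big_seq => t tl.
  by rewrite -scaler_suml coef// lD.
apply: (le_trans (nr_sum _ _)).
rewrite -[leRHS]mul1r -csum mulr_suml; apply: ler_sum => k _.
rewrite nrZR// ler_wpM2l//; have [ghom _ _] := gammaP (gP k).
exact: star_hom_contractive.
Qed.

Lemma fejer_mean_near l (e : R) : 0 < e ->
  exists2 N, (0 < N)%N & nr (total l - fejer_mean N l) < e.
Proof.
move=> e0; pose K : R := \sum_(t <- l) (`|t.1|.*2)%:R * nr t.2.
have K0 : 0 <= K by apply: sumr_ge0 => t _; rewrite mulr_ge0// nr_ge0.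
have [N KN] : exists N : nat, K / e < N.+1%:R.
  by exists (Num.truncn (K / e)); exact: truncnS_gt.
exists N.+1 => //; have NR : 0 < N.+1%:R :> R by rewrite ltr0n.
apply: (@le_lt_trans _ _ (K / N.+1%:R)); last first.
  by rewrite ltr_pdivrMr// mulrC -ltr_pdivrMr.
rewrite /total /fejer_mean -sumrB (le_trans (nr_sum _ _))// mulr_suml.
apply: ler_sum => t _; have /andP[_ w1] := fejer_weight_bounds N.+1 t.1.
rewrite -[X in X - _]scale1r -scalerBl -(rmorph1 (real_complex R)) -rmorphB/=.
rewrite nrZR ?subr_ge0// mulrAC ler_wpM2r ?nr_ge0//.
exact: fejer_weight_near1.
Qed.

(** The weights vanish for |n| >= N, so only the 2 N degrees from -N to N - 1 can contribute. *)
Lemma fejer_mean_component N l (c : R) : (0 < N)%N -> 0 <= c ->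
  (forall n, nr (component n l) <= c) -> nr (fejer_mean N l) <= (N.*2)%:R * c.
Proof.
move=> N0 c0 lc; pose r := [seq i%:Z - N%:Z | i <- iota 0 N.*2].
have ru : uniq r.
  by rewrite map_inj_uniq ?iota_uniq// => i j /addIr [].
have -> : fejer_mean N l =
    \sum_(n <- r) (fejer_weight N n)%:C%C *: component n l.
  under [RHS]eq_bigr do rewrite /component big_mkcond scaler_sumr.
  rewrite exchange_big/=; apply: eq_bigr => t _.
  have [tr|tr] := boolP (t.1 \in r).
    rewrite (bigD1_seq t.1)//= eqxx big1 ?addr0// => n /negPf nt.
    by rewrite eq_sym nt scaler0.
  rewrite big_seq big1 => [|n nr0]; last first.
    by case: eqP => [tn|_]; [move: tr; rewrite tn nr0|rewrite scaler0].
  rewrite /fejer_weight fejer_count_out ?mul0r ?scale0r//.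
  rewrite leqNgt; apply: contra tr => tN; apply/mapP.
  by exists `|(t.1 + N%:Z)%R|%N; [rewrite mem_iota; lia|lia].
apply: (le_trans (nr_sum _ _)).
apply: (@le_trans _ _ (\sum_(n <- r) c)); last first.
  rewrite big_const_seq count_predT iter_addr_0 size_map size_iota.
  by rewrite mulr_natl.
apply: ler_sum => n _; have /andP[w0 w1] := fejer_weight_bounds N n.
by rewrite nrZR//; have := lc n; have := nr_ge0 (component n l); nra.
Qed.

(** [c] must not depend on [e]. One approximation [l0] fixes the order [N]. For any other [l],
    contractivity on the formal difference of [l] and [l0] keeps [fejer_mean N l] near [a], and this
    mean involves at most 2 N components, so one of them is large. *)
Lemma component_lower_bound a : generates (range p `|` range s) ->
  row_finite E -> CK_family p s -> a <> 0 ->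
    exists2 c : R, 0 < c & forall e : R, 0 < e ->
  exists l n, [/\ graded p s l, nr (a - total l) < e & c <= nr (component n l)].
Proof.
(* If all components were small, |a| would be at most 5 d: [d] from a to the total of [l0], [d] from
   there to its Fejer mean, 2 d from that to the mean of [l], and [d] for the latter. *)
move=> gen Efin CK /nr_gt0 a0; pose d := nr a / 8;
  have d0 : 0 < d by rewrite divr_gt0.
have dense (e : R) : 0 < e -> exists2 l, graded p s l & nr (a - total l) < e.
  move=> e0; have [b /algebraic_graded[l lg ->] ab] :=
    @algebraic_dense _ _ _ _ _ Efin CK a e gen e0.
  by exists l.
have [l0 l0g l0d] := dense d d0; have [N N0 lN] := fejer_mean_near l0 d0.
have N2 : 0 < (N.*2)%:R :> R by rewrite ltr0n double_gt0.
exists (d / (N.*2)%:R) => [|e e0]; first exact: divr_gt0.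
have [|l lg ld] := dense (Num.min e d); first by rewrite lt_min e0.
move: ld; rewrite lt_min => /andP[le ld]; exists l.
apply: contrapT => none.
have small n : nr (component n l) <= d / (N.*2)%:R.
  by rewrite leNgt; apply/negP => h; apply: none; exists n; split=> //;
    exact: ltW.
have l1 := fejer_mean_component N0 (ltW (divr_gt0 d0 N2)) small.
rewrite mulrC divfK ?lt0r_neq0// in l1.
pose dl := l ++ [seq (t.1, - t.2) | t <- l0].
have dlg : graded p s dl.
  move=> t; rewrite mem_cat => /orP[/lg//|/mapP[t' /l0g ht ->]] /=.
  by rewrite -scaleN1r; exact: lspanZ.
have := fejer_mean_contract N0 dlg.
have -> : total dl = total l - total l0.
  by rewrite /total /dl big_cat big_map/= sumrN.
have -> : fejer_mean N dl = fejer_mean N l - fejer_mean N l0.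
  rewrite /fejer_mean /dl big_cat big_map/= -sumrN; congr (_ + _).
  by apply: eq_bigr => t _; rewrite scalerN.
have := nrBB a (total l) (total l0); rewrite [nr (total l - a)]nrC.
have := nrBB (total l0) a 0; rewrite !subr0.
have := nrBB (fejer_mean N l0) (total l0) 0; rewrite !subr0.
have := nrBB (fejer_mean N l) (fejer_mean N l0) 0; rewrite !subr0.
rewrite [nr (fejer_mean N l0 - _)]nrC.
have aE : nr a = 8 * d by rewrite /d mulrC divfK.
suff : d < d -> False by move=> h *; apply: h; lra.
by rewrite ltxx.
Qed.

End Fejer.

(** * Ideals contain vertex projections *)

Section IdealVertex.
Variables (R : realType) (E : digraph) (A : cstarAlgType R).
Variables (p : vertex E -> A) (s : edge E -> A) (gamma : R[i] -> A -> A).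
Hypotheses (Efin : row_finite E) (EL : condition_L E) (CK : CK_family p s).
Hypotheses (gen : generates (range p `|` range s)).
Hypotheses (gammaP : is_gauge_action p s gamma) (p_neq0 : forall v, p v <> 0).

Lemma nr_vertex v : nr (p v) = 1.
Proof.
have pP := CK_proj CK v; apply/eqP; rewrite eq_le nr_proj//=.
have p0 := nr_gt0 (p_neq0 (v := v)); have [pT pp] := pP.
have := nr_cstarM (p v); rewrite pT pp expr2 => pE.
by rewrite -(ler_pM2r p0) mul1r -pE.
Qed.

Lemma level_vec_homog k w j a : level_vec p s k w j a -> homog p s j a.
Proof.
apply: lspan_bind => _ [x [[vx _ <- _] ->]]; apply: lspan_incl.
exact: monomial_SS.
Qed.

Definition off_degree (a : A) : Prop := exists d, d != 0 /\ monomial p s d a.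

Definition off_degree_le (L : nat) (a : A) : Prop := exists x y,
  [/\ matched x y, size x.2 != size y.2, (size x.2 <= L)%N, (size y.2 <= L)%N
    & a = TT p s x y].

(** Finitely many monomials occur, so one [L] bounds their lengths and a single escaping path kills
    them all. *)
Lemma off_degree_bounded a : lspan off_degree a ->
  exists L, lspan (off_degree_le L) a.
Proof.
elim=> [|c b e [d [d0 [x [y [xy xyd bE]]]]] _ [L IH]].
  by exists 0%N; exact: lspan0.
exists (maxn L (maxn (size x.2) (size y.2))); apply: lspan_cons.
  exists x, y; split=> //; [|lia|lia].
  by apply: contra_neq d0 => xy2; rewrite -xyd /glen xy2 subrr.
apply: lspan_bind IH => _ [x' [y' [? ? ? ? ->]]]; apply: lspan_incl.
by exists x', y'; split=> //; lia.
Qed.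

Lemma ideal_vertex (K : set A) a : closed_ideal K -> K a -> a <> 0 ->
  exists v, K (p v).
Proof.
move=> KI Ka a0.
have [c c0 cP] := component_lower_bound gammaP gen Efin CK a0.
(* Below [c], so that [b] stretches some [xi] by more than [T], while [total l] is taken within [T]
   of [a]. *)
pose T := c / 2; have T0 : 0 < T by rewrite divr_gt0.
have [l [n [lg al cn]]] := cP T T0.
have hb := component_homog n lg; set b := component n l in cn hb.
have [k0 kP] := homog_level Efin CK hb; have hbk := kP k0 (lexx _).
have Tb : T < nr b by rewrite /T; lra.
have [w [j [xi [hxi Txi]]]] := norm_attained Efin CK hbk (ltW T0) Tb.
set eta := b ** xi in Txi.
have heta : level_vec p s (k0 + n) w (j + n) eta by exact: level_op_vec hxi.
have eta0 : 0 < nr eta by apply: le_lt_trans Txi;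
  rewrite mulr_ge0 ?nr_ge0// ltW.
have [z etaz] := level_vec_inner Efin CK heta heta.
pose zn : R := complex.Re `|z|.
have znE : zn = nr eta ^+ 2 by rewrite -nr_cstarM etaz nrZ nr_vertex mulr1.
have z0 : z != 0.
  apply: contraTneq eta0 => z0;
    rewrite -leNgt -(@ler_sqr _ (nr eta)) ?nnegrE ?nr_ge0//.
  by rewrite -znE /zn z0 normr0 expr0n.
pose r := cstar eta ** (\sum_(t <- l | t.1 != n) t.2) ** xi.
have hr : lspan off_degree r.
  rewrite /r -big_filter mulc_sumr mulc_suml; apply: lspan_sum => t.
  rewrite mem_filter => /andP[tn /lg ht].
  have he := homog_cstar (level_vec_homog heta).
  have := homogM Efin CK (homogM Efin CK he ht) (level_vec_homog hxi).
  (* This degree is t.1 - n, hence not 0. *)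
  apply: lspan_bind => e he'; apply: lspan_incl; exists (- (j + n) + t.1 + j).
  split=> //; apply: contra_neq tn; rewrite addrAC opprD (addrAC (- j)).
  by rewrite addNr add0r addrC => /eqP; rewrite subr_eq0 => /eqP.
have [L {}hr] := off_degree_bounded hr.
have [t [tw esc]] := escaping_exists w L EL; have [vt _] := esc.
set St := SS p s t; pose v := gend t.
have r0 : cstar St ** r ** St = 0.
  apply: (lspan_eq0 (f := fun a => cstar St ** a ** St)) hr.
  - by move=> x y; rewrite cmulDr cmulDl.
  - by move=> q x; rewrite cmulZr cmulZl.
  - by move=> _ [x [y [xy sxy xL yL ->]]]; exact: (escaping_kill Efin CK esc).
have lE : cstar eta ** total l ** xi = z *: p w + r.
  rewrite /total (bigID (fun t =>
    t.1 == n))/= -/(component n l) -/b cmulDr cmulDl.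
  by rewrite -/r -etaz /eta cmulA.
have corner : cstar St ** (cstar eta ** total l ** xi) ** St = z *: p v.
  rewrite lE cmulDr cmulDl r0 addr0 cmulZr cmulZl -tw -cmulA.
  by rewrite (SS_l Efin CK vt) (SS_iso Efin CK vt).
(* [q] is in [K], and |p v - q| <= |eta| T |xi| / |z| < 1 because T |xi| < |eta| and |z| =
   |eta|^2. *)
exists v; pose q := z^-1 *: (cstar St ** (cstar eta ** a ** xi) ** St).
apply: (ideal_approx_proj KI (CK_proj CK v) (k := q)).
  apply: (Defs.idealZ KI); apply: (Defs.idealMr KI); apply: (Defs.idealMl KI).
  by apply: (Defs.idealMr KI); exact: (Defs.idealMl KI).
have -> : p v - q =
    z^-1 *: (cstar St ** (cstar eta ** (total l - a) ** xi) ** St).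
  rewrite /q !(mulBc, mulcB) scalerBr corner scalerA mulVf// scale1r//.
rewrite nrZ normrV ?unitfE//.
have -> : complex.Re `|z|^-1 = zn^-1.
  have {1}-> : `|z| = zn%:C%C by rewrite /zn RRe_real// realE normr_ge0.
  by rewrite -fmorphV.
have zn0 : 0 < zn by rewrite znE exprn_gt0.
rewrite mulrC ltr_pdivrMr// mul1r znE expr2.
have St1 : nr St <= 1 by exact: nr_SS.
set y := cstar eta ** _ ** xi.
have y1 : nr y <= nr eta * (T * nr xi).
  apply: (le_trans (nrM _ _)); rewrite mulrA ler_wpM2r ?nr_ge0//.
  apply: (le_trans (nrM _ _)); rewrite nr_cstar ler_wpM2l ?nr_ge0//.
  by rewrite nrC ltW.
have y2 : nr y < nr eta * nr eta by apply: (le_lt_trans y1); rewrite ltr_pM2l.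
apply: le_lt_trans y2; apply: (le_trans (nrM _ _)).
apply: (@le_trans _ _ (nr (cstar St ** y))); first by rewrite ler_piMr ?nr_ge0.
by apply: (le_trans (nrM _ _)); rewrite nr_cstar ler_piMl ?nr_ge0.
Qed.

End IdealVertex.

(** * From vertex projections to gauge invariance *)

Theorem proposition3p7 (R : realType) (E : digraph) (A : cstarAlgType R)
    (p : vertex E -> A) (s : edge E -> A) (gamma : R[i] -> A -> A)
    (J : set A) :
  row_finite E ->
  condition_L E ->
  is_graph_algebra p s ->
  is_gauge_action p s gamma ->
  regular_ideal J ->
  gauge_invariant gamma J.
Proof.
move=> Efin EL graph gammaP [JI JE]; have [CK gen _] := graph.
have p0 v : p v <> 0 by exact: (graph_algebra_vertex_neq0 Efin graph).
have PI := perp_ideal JI.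
have gammaK (z y : R[i]) : `|z| = 1 -> `|y| = 1 -> y * z = 1 ->
    forall a, gamma y (gamma z a) = a.
  move=> z1 y1 yz; have [zh zp zs] := gammaP z z1;
    have [yh yp ys] := gammaP y y1.
  apply: (star_hom_ext (f := gamma y \o gamma z) (g := id) _ _ gen).
  - split=> [k a b|a b|a] /=.
    + by rewrite (star_hom_linear zh) (star_hom_linear yh).
    + by rewrite (star_homM zh) (star_homM yh).
    + by rewrite (star_hom_cstar zh) (star_hom_cstar yh).
  - by split.
  - move=> _ [[v _ <-]|[e _ <-]] /=; first by rewrite zp yp.
    by rewrite zs (star_homZ yh) ys scalerA mulrC yz scale1r.
have conj1 (z : R[i]) : `|z| = 1 -> `|Num.conj z| = 1 /\ Num.conj z * z = 1.
  by move=> z1; rewrite norm_conjC z1 mulrC -normCK z1 expr1n.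
have stable (z : R[i]) a : `|z| = 1 -> J a -> J (gamma z a).
  move=> z1 Ja; have [y1 yz] := conj1 z z1; set y := Num.conj z in y1 yz.
  have [yh yp _] := gammaP y y1; pose K := perp J `&` gamma y @^-1` J.
  have KI : closed_ideal K by apply: idealI => //; exact: star_hom_preim_ideal.
  have K0 b : K b -> b = 0.
    move=> Kb; apply: contrapT => b0.
    have [v [Pv Jv]] := ideal_vertex Efin EL CK gen gammaP p0 KI Kb b0.
    have {}Jv : J (p v) by rewrite -(yp v).
    by apply: (p0 v); rewrite -(CK_pp CK v); exact: (Pv _ Jv).1.
  (* Both products lie in the ideal [perp J]; [gamma y] maps them to [a ** gamma y x] and
     [gamma y x ** a], which are in [J]. *)
  rewrite JE => x Px; split; apply: K0; split.
  - exact: (Defs.idealMl PI).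
  - by rewrite /preimage/= (star_homM yh) gammaK//; exact: (Defs.idealMr JI).
  - exact: (Defs.idealMr PI).
  - by rewrite /preimage/= (star_homM yh) gammaK//; exact: (Defs.idealMl JI).
move=> z z1; have [y1 yz] := conj1 z z1; apply/seteqP;
  split=> [_ [a Ja <-]|a Ja].
  exact: stable.
exists (gamma (Num.conj z) a); first exact: stable.
by rewrite gammaK// mulrC.
Qed.
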